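(* Let $k$ be an integer with $k\geq 2$. For any positive integer $n$, put \[ r(n)=\#\{(p,j)\in\mathbb{P}\times\mathbb{N}:\ p+j^k=n\}. \] Then there are constants $c_1(k)>0$ and $c_2(k)>0$, depending only on $k$, such that \[ \#\left\{1\leq n\leq x:\ r(n)\geq c_1(k)\frac{x^{1/k}}{\ln x}\right\}\geq c_2(k)x \] for any real number $x\geq 3$. In particular, \[ \#\{1\leq n\leq x:\ \text{there are } p\in\mathbb{P}\text{ and } j\in\mathbb{N}\text{ such that } p+j^k=n\}\geq c_2(k)x \] for any real number $x\geq 3$.
   Context: $\mathbb{N}$ is the set of positive integers, $\mathbb{P}$ the set of prime numbers; the variable $n$ in the counted sets runs over integers; $\ln$ is the natural logarithm. *)

(* Defs.v *)
From HB Require Import structures.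
From mathcomp Require Import all_boot all_order all_algebra finmap.
From mathcomp Require Import all_classical all_reals all_analysis.

Set Implicit Arguments.
Unset Strict Implicit.
Unset Printing Implicit Defensive.

Import Order.TTheory GRing.Theory Num.Theory.

Local Open Scope classical_set_scope.

Definition representations (k n : nat) : set (nat * nat) :=
  [set pj | [/\ prime pj.1, (0 < pj.2)%N & (pj.1 + pj.2 ^ k)%N = n]].

(* [fset_set] is the empty finite set on infinite sets; the two finiteness
   lemmas below show that this never happens in [repr_count] for [0 < k], nor
   in [count_upto]. *)
Definition repr_count (k n : nat) : nat := #|` fset_set (representations k n)|.

Definition upto (R : realType) (x : R) (P : nat -> Prop) : set nat :=
  [set n | [/\ (1 <= n)%N, (n%:R <= x)%R & P n]].

Definition count_upto (R : realType) (x : R) (P : nat -> Prop) : nat :=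
  #|` fset_set (upto x P)|.

Lemma finite_representations (k n : nat) :
  (0 < k)%N -> finite_set (representations k n).
Proof.
move=> k_gt0.
apply: (@sub_finite_set _ _ (`I_n.+1 `*` `I_n.+1)); last first.
  by apply: finite_setX; apply: finite_II.
move=> [p j] [/= _ j_gt0 <-]; split => /=; rewrite ltnS ?leq_addr//.
apply: leq_trans (leq_addl _ _); rewrite -[leqLHS]expn1.
exact: leq_pexp2l.
Qed.

Lemma finite_upto (R : realType) (x : R) (P : nat -> Prop) :
  finite_set (upto x P).
Proof.
apply: (@sub_finite_set _ _ (`I_(Num.truncn x).+1)); last exact: finite_II.
move=> n [/= _ n_le_x _]; rewrite ltnS.
have x_ge0 : (0 <= x)%R by apply: le_trans n_le_x.
by rewrite truncn_ge_nat.
Qed.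

(* Main.v *)
Require Import Defs.
From HB Require Import structures.
From mathcomp Require Import all_boot all_order all_algebra finmap.
From mathcomp Require Import all_classical all_reals all_analysis.
From mathcomp Require Import ring lra zify.
From mathcomp Require Import fintype finset.

Import Order.TTheory GRing.Theory Num.Theory.

Local Open Scope ring_scope.

Set Implicit Arguments.
Unset Strict Implicit.

(** The proof is Romanoff's second moment argument, with an upper bound sieve.
    Let rep n count the representations n = p + j ^ k with p <= X and j <= y,
    where X = y ^ k.  The mean of rep over n <= 2 X is at least of order y / ln X,
    by Chebyshev's lower bound for the number of primes
    ([sum_card_bounded_reps], [prime_count_ge]).  If the mean square is at most a constant times the
    square of the mean, then the Cauchy-Schwarz inequality shows that a positive
    proportion of the n <= 2 X have rep n at least a fixed fraction of the mean
    ([card_ge_of_second_moment]).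

    The sum of rep n ^ 2 counts the solutions of p + i ^ k = p' + j ^ k, that is,
    for each (i, j), pairs of primes at the distance h = |i ^ k - j ^ k|.
    Selberg's sieve ([selberg_sieve]) bounds the number of such pairs below N by
    N / G + O(z ^ 6), where G is a sum over squarefree d <= z with no common
    factor with 2 h ([prime_pair_sieve]).  The main point is to have a lower
    bound for G that is cheap to prove and whose dependence on h can be averaged.
    Take z = w ^ 2, and let F(h) be the sum of 1 / d over the squarefree divisors
    d <= w of 2 h.  Multiplying out, G is at least the square of the sum of 1 / d
    over squarefree d <= w prime to 2 h, and that sum times F(h) is at least the
    sum of 1 / d over all squarefree d <= w, which is at least (ln w) / 2
    ([sieve_sum_ge]), by comparison with the harmonic series.  So the number of
    pairs is O(N F(h) ^ 2 / (ln w) ^ 2).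

    Because F is truncated at w, F(h) ^ 2 is at most a sum of weights over the
    squarefree divisors of 2 h up to w ^ 2, which does not exceed y.  A prime p
    divides 2 (i ^ k - j ^ k) for at most k residues of i modulo p, since
    a polynomial of degree k has at most k roots in a field, so by the
    Chinese remainder theorem the mean of F(h) ^ 2 over i, j is at most
    a constant times the product of the 1 + 3 k / p ^ 2, which converges
    ([divisor_weight_average]).  The pairs with i = j, where h = 0, are covered
    by the same bounds.

    All sizes are powers of one integer w: y = w ^ 7 and X = w ^ (7 k).  A real x
    is then enclosed between 2 w ^ (7 k) and 2 (w + 1) ^ (7 k); the case w = 1,
    where x is bounded, is settled by 3 = 2 + 1 ^ k. *)

(** * Sums over the subsets of a finite set *)

Lemma ler_sum_inj (R : numDomainType) (S T : finType) (h : S -> T)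
    (P : pred S) (Q : pred T) (F : T -> R) :
  {in P &, injective h} -> (forall a, P a -> Q (h a)) ->
  (forall b, Q b -> 0 <= F b) ->
  \sum_(a | P a) F (h a) <= \sum_(b | Q b) F b.
Proof.
move=> hI PQ F0.
rewrite -(big_imset (A := P) F hI) /= [leRHS](bigID (fun b => b \in h @: P)) /=.
have E : forall b, (Q b && (b \in h @: P)) = (b \in h @: P).
  move=> b; apply/andb_idl => /imsetP[a Pa ->]; exact: PQ.
by rewrite (eq_bigl _ _ E) lerDl sumr_ge0// => b /andP[/F0].
Qed.

(** Both sides count the indices of [A :&: B] twice and the other indices of
    [A :|: B] once. *)
Lemma big_setU_setI (T : Type) (idx : T) (op : Monoid.com_law idx)
    (I : finType) (x : I -> T) (A B : {set I}) :
  op (\big[op/idx]_(i in A :|: B) x i) (\big[op/idx]_(i in A :&: B) x i) =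
  op (\big[op/idx]_(i in A) x i) (\big[op/idx]_(i in B) x i).
Proof.
rewrite (big_setID B) /= setIUl setIid setDUl setDv setU0.
have -> : (A :&: B) :|: B = B by apply/setUidPr; apply: subsetIr.
rewrite [in RHS](big_setID (A := A) B) /=.
by rewrite [RHS]Monoid.mulmC -!Monoid.mulmA; congr (op _ _); apply: Monoid.mulmC.
Qed.

Lemma prod_if_in (R : comNzRingType) (I : finType) (x : I -> R)
    (A : {set I}) :
  \prod_i (if i \in A then x i else 1) = \prod_(i in A) x i.
Proof. by rewrite [RHS]big_mkcond. Qed.

Lemma sum_subset_prod (R : comNzRingType) (I : finType) (x : I -> R)
    (A : {set I}) :
  \sum_(E : {set I} | E \subset A) \prod_(i in E) x i = \prod_(i in A) (1 + x i).
Proof.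
rewrite -prod_if_in.
transitivity (\prod_i ((if i \in A then x i else 0) + 1));
  last by apply: eq_bigr => i _; case: ifP; rewrite ?add0r // addrC.
rewrite bigA_distr /= big_mkcond /=; apply: eq_bigr => E _.
case: ifPn => [sEA|/subsetPn[i iE iA]].
  rewrite -prod_if_in; apply: eq_bigr => i _.
  by case: ifP => // /(subsetP sEA) ->.
by rewrite (bigD1 i) //= iE (negbTE iA) mul0r.
Qed.

(** For fixed [A], the sets [B] with [A :|: B = U] are the [(U :\: A) :|: E] with
    [E] a subset of [A]; expanding two products of binomials gives the sum.  In
    terms of squarefree integers this sums 1 / (a b) over the a, b whose least
    common multiple is u. *)
Lemma sum_union_prod (R : fieldType) (I : finType) (x : I -> R)
    (U : {set I}) :
  \sum_(p : {set I} * {set I} | p.1 :|: p.2 == U)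
     (\prod_(i in p.1) x i) * (\prod_(i in p.2) x i) =
  \prod_(i in U) (2 * x i + x i ^+ 2).
Proof.
transitivity (\sum_(A : {set I} | A \subset U)
    \sum_(E : {set I} | E \subset A)
       (\prod_(i in A) x i) * (\prod_(i in (U :\: A) :|: E) x i)).
  rewrite (eq_bigl (fun p : {set I} * {set I} =>
     (p.1 \subset U) && (p.1 :|: p.2 == U))); last first.
    by move=> [A B] /=; apply/esym/andb_idl => /eqP <-; apply: subsetUl.
  rewrite -(pair_big_dep (fun A : {set I} => A \subset U)
    (fun A B => A :|: B == U)
    (fun A B => (\prod_(i in A) x i) * (\prod_(i in B) x i))) /=.
  apply: eq_bigr => A sAU.
  rewrite (reindex_onto (fun E => (U :\: A) :|: E) (fun B => B :&: A)) /=.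
    apply: eq_bigl => E; apply/andP/idP => [[_ /eqP <-]|sEA].
      by apply: subsetIr.
    split; apply/eqP/setP => i; rewrite !inE;
    move/subsetP/(_ i)/implyP: sAU; move/subsetP/(_ i)/implyP: sEA;
    by case: (i \in E); case: (i \in A); case: (i \in U).
  move=> B /eqP <-; apply/setP => i; rewrite !inE.
  by case: (i \in A); case: (i \in B).
transitivity (\sum_(A : {set I} | A \subset U)
   (\prod_(i in U) x i) * \prod_(i in A) (1 + x i)).
  apply: eq_bigr => A sAU; rewrite -sum_subset_prod mulr_sumr.
  apply: eq_bigr => E sEA; rewrite -(big_setU_setI *%R).
  have -> : A :|: (U :\: A :|: E) = U.
    apply/setP => i; rewrite !inE.
    move/subsetP/(_ i)/implyP: sAU; move/subsetP/(_ i)/implyP: sEA.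
    by case: (i \in E); case: (i \in A); case: (i \in U).
  congr (_ * _); apply: eq_bigl => i; rewrite !inE.
  move/subsetP/(_ i)/implyP: sEA.
  by case: (i \in E); case: (i \in A); case: (i \in U).
rewrite -mulr_sumr sum_subset_prod -big_split /=.
by apply: eq_bigr => i _; ring.
Qed.

(** A square of a sum over squarefree integers is bounded by a single such sum, by
    collecting the pairs of sets that have a given union.  It serves in both
    directions: to bound the main term of the sieve from below and the divisor
    weight of [h] from above. *)
Lemma square_sum_le_union (R : realFieldType) (I : finType) (x : I -> R)
    (D E : pred {set I}) :
  (forall i, 0 <= x i) ->
  (forall A B, D A -> D B -> E (A :|: B)) ->
  (\sum_(A | D A) \prod_(i in A) x i) ^+ 2 <=
  \sum_(U | E U) \prod_(i in U) (2 * x i + x i ^+ 2).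
Proof.
move=> x0 DE.
have p0 (A : {set I}) : 0 <= \prod_(i in A) x i by apply: prodr_ge0.
under [leRHS]eq_bigr do rewrite -sum_union_prod.
rewrite expr2 big_distrlr /= pair_big /=.
rewrite (partition_big (fun p : {set I} * {set I} => p.1 :|: p.2) E) /=;
  last by move=> p /andP[]; apply: DE.
apply: ler_sum => U _; rewrite [leRHS]big_mkcond [leLHS]big_mkcond /=.
apply: ler_sum => p _; case: (p.1 :|: p.2 == U); rewrite ?andbF ?andbT //.
by case: ifP => // _; apply: mulr_ge0.
Qed.

(** Each set is determined by its part inside [Q] and its part outside [Q]: a
    squarefree integer is the product of its part composed of the primes in [Q]
    and of the complementary part. *)
Lemma sum_le_split (R : realFieldType) (I : finType) (x : I -> R)
    (D E F : pred {set I}) (Q : {set I}) :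
  (forall i, 0 <= x i) ->
  (forall A, D A -> E (A :&: Q) && F (A :\: Q)) ->
  \sum_(A | D A) \prod_(i in A) x i <=
  (\sum_(A | E A) \prod_(i in A) x i) * (\sum_(A | F A) \prod_(i in A) x i).
Proof.
move=> x0 DEF.
rewrite big_distrlr /= pair_big /=.
under eq_bigr => A _ do rewrite (big_setID Q) /=.
apply: (ler_sum_inj (h := fun A => (A :&: Q, A :\: Q))
   (F := fun p => (\prod_(i in p.1) x i) * (\prod_(i in p.2) x i))).
- by move=> A B _ _ [EI ED]; rewrite -(setID A Q) EI ED setID.
- exact: DEF.
- by move=> p _; apply: mulr_ge0; apply: prodr_ge0.
Qed.

(** Moebius inversion on the lattice of subsets: the sum is the expansion of a
    product that has a vanishing factor unless the interval consists of a single set. *)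
Lemma sum_interval_sign (R : comNzRingType) (I : finType) (E C : {set I}) :
  \sum_(A : {set I} | (E \subset A) && (A \subset C)) (-1) ^+ #|A| =
  if E == C then (-1) ^+ #|E| else 0 :> R.
Proof.
transitivity (\prod_i ((if i \in C then -1 else 0) + (if i \in E then 0 else 1)) : R).
  rewrite bigA_distr big_mkcond /=; apply: eq_bigr => A _.
  case: ifPn => [/andP[/subsetP EA /subsetP AC]|].
    rewrite -prodr_const -prod_if_in; apply: eq_bigr => i _.
    case: ifPn => [/AC -> //|iA]; case: ifP => // /EA iA'.
    by rewrite iA' in iA.
  rewrite negb_and => /orP[] /subsetPn[i i1 /negbTE i2];
  by rewrite (bigD1 i) //= i2 i1 mul0r.
case: eqP => [->|/eqP].
  rewrite -prodr_const -prod_if_in; apply: eq_bigr => i _.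
  by case: ifP; rewrite ?addr0 ?add0r.
rewrite eqEsubset negb_and => /orP[] /subsetPn[i i1 /negbTE i2];
by rewrite (bigD1 i) //= i1 i2 ?addr0 ?addNr mul0r.
Qed.

(** * Selberg's sieve *)

(** Selberg's sieve, with squarefree moduli replaced by sets of primes.  [B v] is
    the set of primes at which [v] falls in a forbidden residue class, [g] is the
    density of the forbidden classes, and [D] the family of admissible moduli.
    If [lam set0 = 1], the square of the sum of the [lam A] over [A] contained
    in [B v] is a majorant of the indicator of [B v == set0].  Summing it over [v]
    gives a quadratic form in [lam], which is diagonalised by expanding the
    inverse of the density of [A :&: C] over its subsets; the [lam] below is the
    minimiser, and the minimum is the inverse of the sum in the statement.  The
    crude bound of [lam A] by the inverse of the density of [A] is enough for the
    remainder. *)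
Lemma selberg_sieve (R : realFieldType) (I V : finType) (B : V -> {set I})
    (D : pred {set I}) (g : I -> R) (X : R) (e : {set I} -> R) :
  (forall i, 0 < g i < 1) -> D set0 ->
  (forall A C : {set I}, A \subset C -> D C -> D A) ->
  (forall A C, D A -> D C ->
     `|#|[set v | A :|: C \subset B v]|%:R - X * \prod_(i in A :|: C) g i|
       <= e (A :|: C)) ->
  #|[set v | B v == set0]|%:R <=
    X / (\sum_(A | D A) \prod_(i in A) (g i / (1 - g i))) +
    \sum_(A | D A) \sum_(C | D C)
      (\prod_(i in A) g i)^-1 * (\prod_(i in C) g i)^-1 * e (A :|: C).
Proof.
move=> g01 D0 Dsub He.
have g0 i : 0 < g i by case/andP: (g01 i).
have g1 i : 0 < 1 - g i by rewrite subr_gt0; case/andP: (g01 i).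
pose t (A : {set I}) := \prod_(i in A) (g i / (1 - g i)).
pose gp (A : {set I}) := \prod_(i in A) g i.
have t0 A : 0 < t A by apply: prodr_gt0 => i _; apply: divr_gt0.
have gp0 A : 0 < gp A by apply: prodr_gt0.
set G := \sum_(A | D A) \prod_(i in A) (g i / (1 - g i)).
have G0 : 0 < G.
  rewrite /G (bigD1 set0) //= big_set0 ltr_pwDl ?ltr01 //.
  by apply: sumr_ge0 => A _; apply: ltW (t0 A).
pose S (A : {set I}) := \sum_(C : {set I} | D C && (A \subset C)) t C.
have S0 A : 0 <= S A by apply: sumr_ge0 => C _; apply: ltW.
have SG A : S A <= G.
  rewrite /G (bigID (fun C : {set I} => A \subset C)) /= lerDl.
  by apply: sumr_ge0 => C _; apply: ltW (t0 C).
(* The minimiser of the quadratic form under the constraint lam set0 = 1. *)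
pose lam (A : {set I}) : R := (-1) ^+ #|A| * (gp A)^-1 * (S A / G).
have lam_le A : `|lam A| <= (gp A)^-1.
  rewrite /lam 2!normrM normrX normrN1 expr1n mul1r (ger0_norm (ltW _)) ?invr_gt0 //.
  rewrite ger_pMr ?invr_gt0 // ger0_norm; last by rewrite divr_ge0 // ltW.
  by rewrite ler_pdivrMr // mul1r.
have lam1 : lam set0 = 1.
  rewrite /lam cards0 expr0 /gp big_set0 invr1 !mul1r /S.
  rewrite (eq_bigl D) -/G ?divff ?gt_eqF // => C.
  by rewrite sub0set andbT.
have lam_sum (E : {set I}) : \sum_(A : {set I} | D A && (E \subset A)) lam A * gp A =
    if D E then (-1) ^+ #|E| * (t E / G) else 0.
  transitivity (\sum_(C | D C) (t C / G) *
     \sum_(A : {set I} | (E \subset A) && (A \subset C)) (-1) ^+ #|A|).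
    transitivity (\sum_(A : {set I} | D A && (E \subset A))
       \sum_(C : {set I} | D C && (A \subset C)) (t C / G) * (-1) ^+ #|A|).
      apply: eq_bigr => A _; rewrite -mulr_suml -[in RHS]mulr_suml -/(S A).
      have h1 := gt_eqF (gp0 A); have h2 := gt_eqF G0.
      by rewrite /lam; field; rewrite h1 h2.
    rewrite (exchange_big_dep D) /=; last by move=> A C _ /andP[].
    apply: eq_bigr => C DC; rewrite mulr_sumr; apply: eq_bigl => A.
    rewrite DC /=; case: (boolP (A \subset C)) => sAC; rewrite ?andbF ?andbT //.
    by rewrite (Dsub _ _ sAC DC).
  under eq_bigr do rewrite sum_interval_sign.
  case: ifPn => DE.
    rewrite (bigD1 E) //= eqxx mulrC big1 ?addr0 // => C /andP[_ CE].
    by rewrite ifN 1?eq_sym // mulr0.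
  apply: big1 => C DC; case: eqP => [EC|]; last by rewrite mulr0.
  by rewrite EC DC in DE.
(* This expansion diagonalises the quadratic form. *)
have gpU (A C : {set I}) : gp (A :|: C) = \sum_(E : {set I})
    (t E)^-1 * ((if E \subset A then gp A else 0) * (if E \subset C then gp C else 0)).
  have -> : gp (A :|: C) = gp A * gp C * (gp (A :&: C))^-1.
    by rewrite /gp -(big_setU_setI *%R) mulfK // lt0r_neq0 //; apply: gp0.
  have -> : (gp (A :&: C))^-1 =
    \sum_(E : {set I} | E \subset A :&: C) (t E)^-1.
    transitivity (\prod_(i in A :&: C) (1 + (g i / (1 - g i))^-1)).
      rewrite /gp -prodfV; apply: eq_bigr => i _.
      have h1 := gt_eqF (g0 i); have h2 := gt_eqF (g1 i).
      by field; rewrite h1 h2.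
    by rewrite -sum_subset_prod; apply: eq_bigr => E _; rewrite /t -prodfV.
  rewrite mulr_sumr big_mkcond /=; apply: eq_bigr => E _.
  rewrite subsetI; case: (E \subset A); case: (E \subset C);
  by rewrite /= ?mulr0 ?mul0r ?mulr0 // mulrC.
have main : \sum_(A | D A) \sum_(C | D C) lam A * lam C * gp (A :|: C) = G^-1.
  transitivity (\sum_(E : {set I}) (t E)^-1 *
      (\sum_(A : {set I} | D A && (E \subset A)) lam A * gp A) ^+ 2).
    transitivity (\sum_(E : {set I}) \sum_(A | D A) \sum_(C | D C)
      (t E)^-1 * ((if E \subset A then lam A * gp A else 0) *
                  (if E \subset C then lam C * gp C else 0))).
      rewrite [RHS]exchange_big /=; apply: eq_bigr => A _.
      rewrite [RHS]exchange_big /=; apply: eq_bigr => C _.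
      rewrite gpU mulr_sumr; apply: eq_bigr => E _.
      by case: (E \subset A); case: (E \subset C); ring.
    apply: eq_bigr => E _; rewrite expr2 !big_mkcondr /= big_distrlr mulr_sumr /=.
    by apply: eq_bigr => A _; rewrite mulr_sumr.
  under eq_bigr do rewrite lam_sum.
  transitivity (\sum_(E | D E) t E * (G^-1 ^+ 2)).
    rewrite [RHS]big_mkcond /=; apply: eq_bigr => E _.
    case: ifP; last by rewrite expr0n /= mulr0.
    move=> _; rewrite exprMn sqrr_sign mul1r.
    have h1 := gt_eqF (t0 E); have h2 := gt_eqF G0.
    by field; rewrite h1 h2.
  rewrite -mulr_suml -/G; have h2 := gt_eqF G0; by field; rewrite h2.
have majorant : #|[set v | B v == set0]|%:R <=
    \sum_v (\sum_(A | D A) (if A \subset B v then lam A else 0)) ^+ 2.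
  rewrite -sum1_card natr_sum big_mkcond /=; apply: ler_sum => v _.
  rewrite inE; case: eqP => [->|_]; last exact: sqr_ge0.
  rewrite (bigD1 set0) //= sub0set lam1 big1 ?addr0 ?expr1n // => A /andP[_ A0].
  by rewrite subset0 (negbTE A0).
apply: le_trans majorant _.
have -> : \sum_v (\sum_(A | D A) (if A \subset B v then lam A else 0)) ^+ 2 =
  \sum_(A | D A) \sum_(C | D C)
     lam A * lam C * #|[set v | A :|: C \subset B v]|%:R.
  under eq_bigr do rewrite expr2 big_distrlr /=.
  rewrite exchange_big /=; apply: eq_bigr => A _.
  rewrite exchange_big /=; apply: eq_bigr => C _.
  rewrite -sum1_card natr_sum mulr_sumr [RHS]big_mkcond /=.
  apply: eq_bigr => v _; rewrite inE subUset.
  by case: (A \subset B v); case: (C \subset B v); rewrite /= ?mulr1 ?mulr0 ?mul0r.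
have -> : X / G = \sum_(A | D A) \sum_(C | D C) lam A * lam C * (X * gp (A :|: C)).
  rewrite -main mulr_sumr; apply: eq_bigr => A _; rewrite mulr_sumr.
  by apply: eq_bigr => C _; ring.
rewrite -big_split /=; apply: ler_sum => A DA.
rewrite -big_split /=; apply: ler_sum => C DC.
rewrite -lerBlDl -mulrBr; apply: le_trans (ler_norm _) _.
rewrite normrM; apply: ler_pM => //; last exact: He.
by rewrite normrM; apply: ler_pM.
Qed.

(** * Counting in residue classes *)

Definition natcount (N : nat) (P : pred nat) : nat :=
  (\sum_(0 <= n < N) P n)%N.

Lemma natcount_card N (P : pred nat) : natcount N P = #|[set n : 'I_N | P n]|.
Proof.
rewrite /natcount big_mkord -sum1_card [RHS]big_mkcond /=.
by apply: eq_bigr => i _; rewrite inE; case: (P i).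
Qed.

Lemma natcount_le N M (P : pred nat) :
  (N <= M)%N -> (natcount N P <= natcount M P)%N.
Proof. by move=> NM; rewrite /natcount [leqRHS](@big_cat_nat _ _ _ N) //= leq_addr. Qed.

Definition periodic (d : nat) (P : pred nat) := forall n, P (n + d)%N = P n.

Lemma periodicM d (P : pred nat) q n : periodic d P -> P (n + q * d)%N = P n.
Proof.
by move=> perP; elim: q => [|q IH]; rewrite ?addn0 // mulSn addnCA addnC perP.
Qed.

Lemma periodic_mod d (P : pred nat) n : periodic d P -> P (n %% d)%N = P n.
Proof. by move=> perP; rewrite {2}(divn_eq n d) addnC periodicM. Qed.

Lemma natcount_periodic d (P : pred nat) q r : periodic d P ->
  natcount (q * d + r) P = (q * natcount d P + natcount r P)%N.
Proof.
move=> perP; elim: q => [|q IH]; first by rewrite !mul0n.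
rewrite !mulSn -!addnA -IH /natcount (@big_cat_nat _ _ _ d) ?leq_addr //=.
congr (_ + _)%N; rewrite -{1}[d]add0n big_addn addKn.
by apply: eq_bigr => i _; rewrite perP.
Qed.

Lemma natcount_density (R : realFieldType) d (P : pred nat) N :
  (0 < d)%N -> periodic d P ->
  `|(natcount N P)%:R - N%:R * ((natcount d P)%:R / d%:R)|
    <= (natcount d P)%:R :> R.
Proof.
move=> d0 perP.
have rd : (N %% d < d)%N by rewrite ltn_mod.
have crd : (natcount (N %% d) P <= natcount d P)%N by apply/natcount_le/ltnW.
rewrite (divn_eq N d) natcount_periodic //.
move: (N %/ d)%N (N %% d)%N rd crd => q r rd crd.
rewrite !natrD !natrM.
set s : R := (natcount d P)%:R; have s0 : 0 <= s by apply: ler0n.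
have dR : (d%:R : R) != 0 by rewrite pnatr_eq0 -lt0n.
have -> : q%:R * s + (natcount r P)%:R - (q%:R * d%:R + r%:R) * (s / d%:R) =
   (natcount r P)%:R - r%:R / d%:R * s by field.
have h1 : 0 <= r%:R / d%:R * s <= s.
  rewrite mulr_ge0 ?divr_ge0 ?ler0n //= ler_piMl //.
  by rewrite ler_pdivrMr ?ltr0n // mul1r ler_nat ltnW.
have h2 : (0 : R) <= (natcount r P)%:R <= s.
  by apply/andP; split; [apply: ler0n | rewrite /s ler_nat].
by rewrite ler_norml; lra.
Qed.

(** The reduction modulo [d1] and [d2] is injective by the Chinese remainder
    theorem, hence bijective by cardinality. *)
Lemma natcount_crt d1 d2 (P1 P2 : pred nat) :
  (0 < d1)%N -> (0 < d2)%N -> coprime d1 d2 ->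
  periodic d1 P1 -> periodic d2 P2 ->
  natcount (d1 * d2) (fun n => P1 n && P2 n) =
  (natcount d1 P1 * natcount d2 P2)%N.
Proof.
move=> d1_gt0 d2_gt0 co per1 per2.
pose f (n : 'I_(d1 * d2)) : 'I_d1 * 'I_d2 :=
  (Ordinal (ltn_pmod n d1_gt0), Ordinal (ltn_pmod n d2_gt0)).
have f_inj : injective f.
  move=> m n [] /eqP e1 /eqP e2; apply/val_inj/eqP => /=.
  rewrite -(modn_small (ltn_ord m)) -(modn_small (ltn_ord n)).
  by rewrite chinese_remainder // e1 e2.
have f_bij : bijective f by apply: inj_card_bij; rewrite ?card_prod ?card_ord.
rewrite /natcount !big_mkord big_distrlr /= pair_big /=.
rewrite (reindex f) /=; last exact: onW_bij.
by apply: eq_bigr => n _; rewrite !periodic_mod //; case: (P1 n); case: (P2 n).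
Qed.

Lemma natcount_primes m (A : {set 'I_m}) (Q : nat -> pred nat) :
  (forall i : 'I_m, i \in A -> prime i) ->
  (forall i : 'I_m, i \in A -> periodic i (Q i)) ->
  periodic (\prod_(i in A) i) (fun n => [forall i in A, Q (i : nat) n]) /\
  natcount (\prod_(i in A) i) (fun n => [forall i in A, Q (i : nat) n]) =
  (\prod_(i in A) natcount i (Q i))%N.
Proof.
move=> prA perA; split=> [n|].
  apply: eq_forallb => i; case: (boolP (i \in A)) => //= iA.
  by rewrite (bigD1 i) //= mulnC periodicM //; apply: perA.
have allE n : [forall i in A, Q (i : nat) n] = all (fun i : 'I_m => Q i n) (enum A).
  apply/forall_inP/allP => H i; first by rewrite mem_enum => /H.
  by move=> iA; apply: H; rewrite mem_enum.
rewrite /natcount; under eq_bigr do rewrite allE; rewrite -/(natcount _ _).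
have prodE (F : 'I_m -> nat) :
    (\prod_(i in A) F i = \prod_(i <- enum A) F i)%N by rewrite big_enum.
rewrite !prodE.
have: {in enum A, forall i : 'I_m, prime i} by move=> i; rewrite mem_enum => /prA.
have: {in enum A, forall i : 'I_m, periodic i (Q i)} by move=> i; rewrite mem_enum => /perA.
elim: (enum A) (enum_uniq A) => [|i s IH] /=.
  by rewrite !big_nil /natcount big_nat1.
case/andP=> is' us pers prs; rewrite !big_cons.
have pers' : {in s, forall i : 'I_m, periodic i (Q i)}.
  by move=> j js; apply: pers; rewrite inE js orbT.
have prs' : {in s, forall i : 'I_m, prime i}.
  by move=> j js; apply: prs; rewrite inE js orbT.
rewrite -(IH us pers' prs') -(@natcount_crt _ _ (Q i)) //.
- by apply: prime_gt0; apply: prs; rewrite mem_head.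
- by rewrite big_seq prodn_cond_gt0 // => j /prs' /prime_gt0.
- rewrite big_seq; elim/big_rec: _ => [|j x js cx]; first exact: coprimen1.
  rewrite coprimeMr cx andbT prime_coprime ?prs ?mem_head //.
  rewrite dvdn_prime2 ?(prs i) ?(prs' j) ?mem_head //.
  by apply: contraNneq is' => /val_inj ->.
- by apply: pers; rewrite mem_head.
- move=> n; apply: eq_in_all => j js.
  by rewrite (big_rem j) //= mulnC periodicM //; apply: pers'.
Qed.

(** * Sieving for pairs of primes *)

Definition setprod (m : nat) (A : {set 'I_m}) : nat := (\prod_(i in A) i)%N.

(** A squarefree integer is encoded as the set of its prime factors: this family
    stands for the squarefree integers up to [w] with all prime factors in [P]. *)
Definition primeset (m : nat) (P : pred nat) (w : nat) : pred {set 'I_m} :=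
  fun A => [forall i in A, prime (i : nat) && P i] && (setprod A <= w)%N.

Lemma primesetP m (P : pred nat) w (A : {set 'I_m}) :
  reflect ((forall i, i \in A -> prime i /\ P i) /\ (setprod A <= w)%N)
          (primeset P w A).
Proof.
apply: (iffP andP) => [[/forall_inP H ->]|[H ->]]; split=> //.
  by move=> i /H /andP.
by apply/forall_inP => i /H [-> ->].
Qed.

Lemma setprod_gt0 m (A : {set 'I_m}) :
  (forall i, i \in A -> prime i) -> (0 < setprod A)%N.
Proof. by move=> H; rewrite /setprod prodn_cond_gt0 // => i /H /prime_gt0. Qed.

Lemma setprodU m (A B : {set 'I_m}) :
  (forall i, i \in A -> prime i) -> (forall i, i \in B -> prime i) ->
  (setprod (A :|: B) <= setprod A * setprod B)%N.
Proof.
move=> prA prB; have prAB : forall i, i \in A :&: B -> prime i.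
  by move=> i /setIP[/prA].
rewrite /setprod -(big_setU_setI muln) -/(setprod _) -/(setprod (A :&: B)).
by rewrite leq_pmulr // setprod_gt0.
Qed.

Lemma setprodS m (A B : {set 'I_m}) : A \subset B ->
  (forall i, i \in B -> prime i) -> (setprod A <= setprod B)%N.
Proof.
move=> sAB prB; rewrite /setprod (big_setID (A := B) A) /=.
rewrite (setIidPr sAB) leq_pmulr //; apply: setprod_gt0 => i.
by case/setDP => /prB.
Qed.

Lemma primesetS m P w (A B : {set 'I_m}) :
  A \subset B -> primeset P w B -> primeset P w A.
Proof.
move=> sAB /primesetP[H1 H2]; apply/primesetP; split.
  by move=> i /(subsetP sAB) /H1.
by apply: leq_trans H2; apply: setprodS => // i /H1[].
Qed.

Lemma primesetU m P w z (A B : {set 'I_m}) :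
  primeset P w A -> primeset P z B -> primeset P (w * z) (A :|: B).
Proof.
move=> /primesetP[H1 H2] /primesetP[H3 H4]; apply/primesetP; split.
  by move=> i /setUP[/H1|/H3].
apply: leq_trans (leq_mul H2 H4); apply: setprodU => i; first by case/H1.
by case/H3.
Qed.

Lemma dvdn_setprod m (A : {set 'I_m}) (p : 'I_m) :
  (forall i, i \in A -> prime i) -> prime p -> (p %| setprod A)%N = (p \in A).
Proof.
move=> prA prp; apply/idP/idP => [|pA]; last by rewrite /setprod (bigD1 p) //= dvdn_mulr.
apply: contraLR => pA; rewrite /setprod; elim/big_rec: _ => [|i x iA px].
  by rewrite gtnNdvd // prime_gt1.
rewrite Euclid_dvdM // negb_or px andbT dvdn_prime2 ?(prA i) //.
by apply: contraNneq pA => /val_inj ->.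
Qed.

Lemma setprod_inj m (A B : {set 'I_m}) :
  (forall i, i \in A -> prime i) -> (forall i, i \in B -> prime i) ->
  setprod A = setprod B -> A = B.
Proof.
move=> prA prB AB; apply/setP => i; case: (boolP (prime i)) => [pri|/negP npr].
  by rewrite -!dvdn_setprod // AB.
by apply/idP/idP => [/prA|/prB].
Qed.

Lemma card_primeset m P w : (#|[set A : {set 'I_m} | primeset P w A]| <= w)%N.
Proof.
pose f (A : {set 'I_m}) : 'I_w.+1 := inord (setprod A).
rewrite -(card_in_imset (f := f)); last first.
  move=> A B; rewrite !inE => /primesetP[prA Aw] /primesetP[prB Bw] /(congr1 val).
by rewrite /= !inordK // => /setprod_inj -> // i; [case/prA|case/prB].
suff /subset_leq_card : f @: [set A : {set 'I_m} | primeset P w A] \subset [set~ ord0].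
  by rewrite cardsC1 card_ord.
apply/subsetP => b /imsetP[A]; rewrite !inE => /primesetP[prA Aw] ->.
rewrite -val_eqE /= inordK // -lt0n setprod_gt0 // => i /prA [] //.
Qed.

(** The two residues are 0 and [- h]; they differ since [p] does not divide [h]. *)
Lemma natcount_dvd_pair p h : prime p -> ~~ (p %| 2 * h)%N ->
  natcount p (fun n => p %| n * (n + h))%N = 2.
Proof.
move=> prp; rewrite Euclid_dvdM // negb_or => /andP[p2 ph].
have p0 := prime_gt0 prp.
have hp : (0 < h %% p)%N by rewrite lt0n.
have hlt : (h %% p < p)%N by rewrite ltn_mod.
have lt : (p - h %% p < p)%N by rewrite ltn_subrL hp p0.
rewrite natcount_card.
have -> : [set n : 'I_p | (p %| n * (n + h))%N] = [set Ordinal p0; Ordinal lt].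
  apply/setP => n; rewrite !inE Euclid_dvdM // -!val_eqE /=.
  have nlt := ltn_ord n; congr (_ || _).
    apply/idP/eqP => [|->]; last exact: dvdn0.
    by move=> /dvdnP[[|q] E]; [rewrite E|move: nlt; rewrite E mulSn; lia].
  have -> : (p %| n + h)%N = (p %| n + h %% p)%N by rewrite /dvdn modnDmr.
  apply/idP/eqP => [/dvdnP[q E]|->]; last by rewrite subnK // ltnW.
  have q1 : q = 1%N by nia.
  by rewrite q1 in E; lia.
by rewrite cards2 -val_eqE /= eq_sym -lt0n subn_gt0 hlt.
Qed.

(** A prime [n > z] with [n + h] prime is divisible by no prime up to [z], and
    neither is [n + h].  Sieving by the odd primes not dividing [h] only, each of
    them forbids exactly two residues, so the density is [2 / i] and the sieve
    weight [g / (1 - g)] is [2 / (i - 2)].  The remainder is summed over at most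
    [z ^ 2] pairs of moduli, with terms at most [z * z * z ^ 2]. *)
Lemma prime_pair_sieve (R : realFieldType) (h z N : nat) : (0 < z)%N ->
  #|[set n : 'I_N | prime n && prime (n + h)%N]|%:R <=
   z.+1%:R +
   N%:R / (\sum_(A : {set 'I_z.+1} | primeset (fun p => ~~ (p %| 2 * h)%N) z A)
             \prod_(i in A) (2 / (i%:R - 2))) + z%:R ^+ 6 :> R.
Proof.
move=> z_gt0; set P := fun p => ~~ (p %| 2 * h)%N.
have P3 p : prime p -> P p -> (3 <= p)%N.
  move=> /prime_gt1; rewrite leq_eqVlt => /orP[/eqP <-|//].
  by rewrite /P dvdn_mulr.
pose Q i n := (i %| n * (n + h))%N.
pose good (i : 'I_z.+1) := prime i && P i.
pose B (n : 'I_N) := [set i : 'I_z.+1 | good i && Q i n].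
(* Indices that are not good lie in no modulus; 1 / 2 is an arbitrary density. *)
pose g (i : 'I_z.+1) : R := if good i then 2 / i%:R else 1 / 2.
have gE (A : {set 'I_z.+1}) w : primeset P w A ->
    \prod_(i in A) g i = \prod_(i in A) (2 / i%:R).
  move=> /primesetP[H _]; apply: eq_bigr => i /H [h1 h2].
  by rewrite /g /good h1 h2.
have goodR i : good i -> (3 : R) <= i%:R.
  by move=> /andP[h1 h2]; rewrite (ler_nat _ 3) P3.
have g01 i : 0 < g i < 1.
  rewrite /g; case: ifP => [/goodR i3|_]; last by apply/andP; lra.
  by rewrite divr_gt0 ?ltr_pdivrMr /=; lra.
have split_count : (#|[set n : 'I_N | prime n && prime (n + h)%N]| <=
   z.+1 + #|[set n | B n == set0]|)%N.
  rewrite -(cardsID [set n : 'I_N | n <= z]%N); apply: leq_add.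
    rewrite -(card_in_imset (f := fun n : 'I_N => inord n : 'I_z.+1)).
      by apply: leq_trans (max_card _) _; rewrite card_ord.
    move=> a b; rewrite !inE => /andP[_ az] /andP[_ bz] /(congr1 val) /=.
    by rewrite !inordK // => /val_inj.
  apply: subset_leq_card; apply/subsetP => n; rewrite !inE -ltnNge.
  move=> /andP[zn /andP[pr1 pr2]]; apply/eqP/setP => i; rewrite !inE.
  apply/negP => /andP[/andP[pri _]]; rewrite /Q Euclid_dvdM // !dvdn_prime2 //.
  by have := ltn_ord i; move=> iz /orP[] /eqP E; move: iz; rewrite E; lia.
apply: le_trans (_ : (z.+1 + #|[set n | B n == set0]|)%:R <= _).
  by rewrite ler_nat.
rewrite natrD -addrA lerD2l.
have dens A C : primeset P z A -> primeset P z C ->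
   `|#|[set n | A :|: C \subset B n]|%:R - N%:R * \prod_(i in A :|: C) g i|
       <= (setprod (A :|: C))%:R :> R.
  move=> DA DC; have DU := primesetU DA DC.
  have /primesetP[prU _] := DU.
  have -> : #|[set n | A :|: C \subset B n]| =
     natcount N (fun n => [forall i in A :|: C, Q (i : nat) n]).
    rewrite natcount_card; congr #|pred_of_set _|; apply/setP => n; rewrite !inE.
    apply/subsetP/forall_inP => H i /[dup] iU /H; first by rewrite inE => /andP[].
    by rewrite inE => ->; have [h1 h2] := prU i iU; rewrite /good h1 h2.
  have prU' i : i \in A :|: C -> prime i by case/prU.
  have perU (i : 'I_z.+1) : i \in A :|: C -> periodic i (Q i).
    move=> /prU' pri n; rewrite /Q !Euclid_dvdM // addnAC.
    by rewrite !(@dvdn_addl i).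
  have [per cnt] := natcount_primes prU' perU.
  (* By the Chinese remainder theorem, two classes modulo each prime of the
     modulus give 2 ^ r classes, where r is the number of these primes. *)
  have cnt2 : natcount (setprod (A :|: C))
      (fun n => [forall i in A :|: C, Q (i : nat) n]) = (2 ^ #|A :|: C|)%N.
    rewrite cnt -prod_nat_const; apply: eq_bigr => i /prU [h1 h2].
    exact: natcount_dvd_pair.
  have := natcount_density R N (setprod_gt0 prU') per; rewrite cnt2.
  have -> : \prod_(i in A :|: C) g i = (2 ^ #|A :|: C|)%:R / (setprod (A :|: C))%:R.
    rewrite (gE _ _ DU) prodf_div natr_prod -prod_nat_const natr_prod //.
  move=> /le_trans; apply.
  rewrite ler_nat -prod_nat_const; apply: leq_prod => i /prU' /prime_gt1 //.
apply: le_trans (selberg_sieve (e := fun U => (setprod U)%:R) g01 _ _ dens) _.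
- apply/primesetP; split=> [i|]; first by rewrite inE.
  by rewrite /setprod big_set0.
- by move=> A C; apply: primesetS.
apply: lerD.
  rewrite le_eqVlt; apply/orP; left; apply/eqP; congr (_ / _); apply: eq_bigr => A /primesetP[prA _].
  apply: eq_bigr => i /prA /andP /[dup] /goodR i3 gi; rewrite /g ifT //.
  by field; lra.
have ginv A : primeset P z A -> 0 <= (\prod_(i in A) g i)^-1 <= z%:R.
  move=> DA; apply/andP; split.
    by rewrite invr_ge0 prodr_ge0 // => i _; apply: ltW; case/andP: (g01 i).
  rewrite (gE _ _ DA) -prodfV; have /primesetP[prA Az] := DA.
  apply: le_trans (_ : (setprod A)%:R <= _); last by rewrite ler_nat.
  rewrite /setprod natr_prod; apply: ler_prod => i /prA /andP /goodR i3.
  by rewrite invf_div divr_ge0 ?ler_pdivrMr //=; lra.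
have -> : z%:R ^+ 6 = z%:R * (z%:R * (z%:R * z%:R * (z * z)%:R)) :> R by rewrite natrM; ring.
have cardle (F : R) : 0 <= F ->
   \sum_(A : {set 'I_z.+1} | primeset P z A) F <= z%:R * F.
  move=> F0; rewrite sumr_const -[F *+ _]mulr_natl ler_wpM2r // ler_nat.
  by apply: leq_trans (card_primeset z.+1 P z); rewrite cardsE.
have z0R : (0 : R) <= z%:R by apply: ler0n.
apply: le_trans (cardle _ _); last by rewrite !mulr_ge0 ?ler0n.
apply: ler_sum => A DA.
apply: le_trans (cardle _ _); last by rewrite !mulr_ge0 ?ler0n.
apply: ler_sum => C DC.
have /andP[a1 a2] := ginv A DA; have /andP[b1 b2] := ginv C DC.
apply: ler_pM; [exact: mulr_ge0 | exact: ler0n | exact: ler_pM |].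
by rewrite ler_nat; have /primesetP[] := primesetU DA DC.
Qed.

(** * The size of the sieve's main term *)

(** By induction, dividing by the least prime factor [p]: if [p] is already in
    [A] it moves to the square part, otherwise it joins [A]. *)
Lemma square_squarefree z n : (0 < n)%N -> (n <= z)%N ->
  exists a (A : {set 'I_z.+1}),
    (forall i, i \in A -> prime i) /\ n = (a ^ 2 * setprod A)%N.
Proof.
elim/ltn_ind: n => n IH n0 nz.
have [n1|n1] := leqP n 1.
  exists 1%N, set0; split=> [i|]; first by rewrite inE.
  by rewrite /setprod big_set0; lia.
have prp := pdiv_prime n1; set p := pdiv n in prp.
have /dvdnP[m nE] : (p %| n)%N := pdiv_dvd n.
have p1 := prime_gt1 prp.
have m0 : (0 < m)%N by case: m nE n0 => [->|].
have mn : (m < n)%N by rewrite nE ltn_Pmulr.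
have [a [A [prA mE]]] := IH m mn m0 (leq_trans (ltnW mn) nz).
have pz : (p < z.+1)%N by rewrite ltnS (leq_trans _ nz) // nE leq_pmull.
pose q := Ordinal pz.
have [qA|qA] := boolP (q \in A).
  exists (p * a)%N, (A :\ q); split=> [i /setD1P[_ /prA] //|].
  by rewrite nE mE /setprod (big_setD1 q qA) /= expnMn; ring.
exists a, (q |: A); split=> [i /setU1P[->|/prA] //|].
by rewrite nE mE /setprod big_setU1 //=; ring.
Qed.

(** The partial sum up to [n] is at most [2 - 1 / n], which telescopes. *)
Lemma sum_inv_squares_le2 (R : realFieldType) (w : nat) :
  \sum_(a < w.+1) (a%:R ^- 2) <= 2 :> R.
Proof.
suff H n : \sum_(a < n.+2) (a%:R ^- 2) <= 2 - n.+1%:R^-1 :> R.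
  case: w => [|w]; first by rewrite big_ord1 expr2 mulr0 invr0.
  apply: le_trans (H w) _; rewrite gerBl invr_ge0 //.
elim: n => [|n IH].
  rewrite big_ord_recl big_ord1 /= expr0n /= invr0 add0r expr1n invr1; lra.
rewrite big_ord_recr /=; apply: le_trans (lerD IH (lexx _)) _.
have n0 : (0 : R) < n.+1%:R by rewrite ltr0n.
rewrite -[n.+2%:R]natr1; move: n0; set x : R := n.+1%:R => x0.
have e1 : x^-1 - (x + 1)^-1 - (x + 1) ^- 2 = x^-1 * (x + 1) ^- 2.
  by field; lra.
have e2 : 0 <= x^-1 * (x + 1) ^- 2.
  by rewrite mulr_ge0 ?invr_ge0 ?exprn_ge0; lra.
rewrite -e1 in e2; move: e2.
by move: (x^-1) ((x + 1)^-1) ((x + 1) ^- 2) => a b c; lra.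
Qed.

(** Writing n as a square times a squarefree integer, the harmonic sum is at most
    the sum of the inverse squares times the sum over squarefree integers. *)
Lemma harmonic_le (R : realFieldType) (w z : nat) : (w <= z)%N ->
  \sum_(1 <= n < w.+1) n%:R^-1 <=
  2 * \sum_(A : {set 'I_z.+1} | primeset predT w A) \prod_(i in A) i%:R^-1 :> R.
Proof.
move=> wz.
have pos (A : {set 'I_z.+1}) : 0 <= \prod_(i in A) (i%:R : R)^-1.
  by apply: prodr_ge0 => i _; rewrite invr_ge0.
apply: le_trans (_ : (\sum_(a < w.+1) (a%:R ^- 2)) *
   \sum_(A : {set 'I_z.+1} | primeset predT w A) \prod_(i in A) i%:R^-1 <= _); last first.
  by apply: ler_wpM2r; [apply: sumr_ge0 | apply: sum_inv_squares_le2].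
have dec (n : 'I_w.+1) : exists p : 'I_w.+1 * {set 'I_z.+1},
  (0 < n)%N -> primeset predT w p.2 /\ (n : nat) = (p.1 ^ 2 * setprod p.2)%N.
  have [n0|n0] := posnP n; first by exists (ord0, set0).
  have nw : (n <= w)%N by rewrite -ltnS.
  have [a [A [prA nE]]] := square_squarefree n0 (leq_trans nw wz).
  have A0 := setprod_gt0 prA.
  have aw : (a < w.+1)%N by rewrite ltnS; apply: leq_trans nw; rewrite nE; nia.
  exists (Ordinal aw, A) => _; split=> //; apply/primesetP; split.
    by move=> i /prA.
  apply: leq_trans nw; rewrite nE leq_pmull // -(ltn_pmul2r A0) -nE mul0n //.
have [f fP] := fin_all_exists dec.
rewrite big_distrlr /= pair_big /= big_geq_mkord /=.
have E (n : 'I_w.+1) : (0 < n)%N ->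
   (n%:R : R)^-1 = (f n).1%:R ^- 2 * \prod_(i in (f n).2) i%:R^-1.
  move=> n0; have [_ nE] := fP n n0.
  by rewrite [in LHS]nE natrM invfM natrX natr_prod prodfV.
under eq_bigr => n n0 do rewrite E //.
apply: (ler_sum_inj (h := f)
  (F := fun p => p.1%:R ^- 2 * \prod_(i in p.2) i%:R^-1)).
- move=> m n m0 n0 mn; apply/val_inj.
  by have [_ /= ->] := fP m m0; have [_ /= ->] := fP n n0; rewrite mn.
- by move=> n /fP[].
- by move=> p _; apply: mulr_ge0; [rewrite invr_ge0 exprn_ge0 | exact: pos].
Qed.

(** The part of the product over the primes dividing [2 * h] of [1 + 1 / p] that
    comes from divisors up to [w].  The truncation costs nothing in the sieve, and
    it keeps all moduli small when averaging over [h]. *)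
Definition divisor_weight (R : realFieldType) (z w h : nat) : R :=
  \sum_(A : {set 'I_z.+1} | primeset (fun p => p %| 2 * h)%N w A)
    \prod_(i in A) i%:R^-1.

Lemma divisor_weight_ge1 (R : realFieldType) z w h : (0 < w)%N -> 1 <= divisor_weight R z w h.
Proof.
move=> w0; rewrite /divisor_weight (bigD1 set0) /=.
  rewrite big_set0 lerDl; apply: sumr_ge0 => A _; apply: prodr_ge0 => i _.
  by rewrite invr_ge0.
apply/primesetP; split=> [i|]; first by rewrite inE.
by rewrite /setprod big_set0.
Qed.

(** Squaring the sum of 1 / d over the squarefree d up to [w] prime to [2 * h] and
    collecting by least common multiple gives at each prime p the factor
    2 / p + 1 / p ^ 2, which is at most 2 / (p - 2).  Restoring the primes that
    divide [2 * h] costs the divisor weight, and restoring the square factors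
    costs 2. *)
Lemma sieve_sum_ge (R : realFieldType) (z w h : nat) : (w * w <= z)%N ->
  (\sum_(1 <= n < w.+1) n%:R^-1) ^+ 2 <=
  4 * divisor_weight R z w h ^+ 2 *
  \sum_(A : {set 'I_z.+1} | primeset (fun p => ~~ (p %| 2 * h)%N) z A)
             \prod_(i in A) (2 / (i%:R - 2)) :> R.
Proof.
move=> wwz; set P := fun p => ~~ (p %| 2 * h)%N.
have wz : (w <= z)%N by apply: leq_trans wwz; case: (w) => // v; rewrite leq_pmulr.
pose x (i : 'I_z.+1) : R := i%:R^-1.
have x0 i : 0 <= x i by rewrite invr_ge0.
pose H := \sum_(A : {set 'I_z.+1} | primeset P w A) \prod_(i in A) x i.
have H0 : 0 <= H by apply: sumr_ge0 => A _; apply: prodr_ge0.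
have step1 := harmonic_le R wz.
have step2 : \sum_(A : {set 'I_z.+1} | primeset predT w A) \prod_(i in A) x i
    <= divisor_weight R z w h * H.
  apply: (@sum_le_split _ _ _ _ _ _ [set i : 'I_z.+1 | i %| 2 * h]%N) => // A DA.
  have /primesetP[prA _] := DA; apply/andP; split; apply/primesetP; split.
  - by move=> i; rewrite !inE => /andP[/prA[]].
  - have /primesetP[_] // : primeset predT w (A :&: [set i : 'I_z.+1 | i %| 2 * h]%N).
    by apply: primesetS DA; apply: subsetIl.
  - by move=> i; rewrite !inE => /andP[? /prA[]].
  - have /primesetP[_] // : primeset predT w (A :\: [set i : 'I_z.+1 | i %| 2 * h]%N).
    by apply: primesetS DA; apply: subsetDl.
have step3 : H ^+ 2 <=
  \sum_(A : {set 'I_z.+1} | primeset P z A) \prod_(i in A) (2 / (i%:R - 2)).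
  apply: le_trans (square_sum_le_union (E := primeset P z) x0 _) _.
    move=> A B DA DB; have /primesetP[h1 h2] := primesetU DA DB.
    by apply/primesetP; split=> //; apply: leq_trans h2 wwz.
  apply: ler_sum => A /primesetP[prA _]; apply: ler_prod => i /prA[pri Pi].
  rewrite addr_ge0 ?mulr_ge0 ?exprn_ge0 //= /x.
  have i3 : (3 : R) <= i%:R.
    rewrite (ler_nat _ 3) ltn_neqAle prime_gt1 // andbT.
    by apply: contraNneq Pi => <-; rewrite dvdn_mulr.
  have -> : 2 / (i%:R - 2) = 2 * i%:R^-1 + i%:R^-1 ^+ 2 +
     (3 * i%:R + 2) / (i%:R ^+ 2 * (i%:R - 2)) :> R by field; lra.
  rewrite lerDl divr_ge0 ?mulr_ge0 ?exprn_ge0; lra.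
apply: le_trans (_ : (2 * (divisor_weight R z w h * H)) ^+ 2 <= _).
  rewrite ler_pXn2r ?nnegrE //.
  - by apply: le_trans step1 _; rewrite ler_wpM2l.
  - by apply: sumr_ge0 => n _; rewrite invr_ge0.
  - rewrite !mulr_ge0 // ?sumr_ge0 // => A _; apply: prodr_ge0 => i _; exact: x0.
have -> : (2 * (divisor_weight R z w h * H)) ^+ 2 = 4 * divisor_weight R z w h ^+ 2 * H ^+ 2 by ring.
by apply: ler_wpM2l step3; rewrite mulr_ge0 // sqr_ge0.
Qed.

(** * Averaging over differences of powers *)

(** These residues are roots of the polynomial [X ^ k - c] over the field with [p]
    elements. *)
Lemma natcount_kth_root p k c : prime p -> (0 < k)%N ->
  (natcount p (fun j => j ^ k == c %[mod p])%N <= k)%N.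
Proof.
move=> prp k0.
pose q : {poly 'F_p} := 'X^k - (c%:R)%:P.
have sq : size q = k.+1 by apply: size_XnsubC.
pose s := [seq (n : nat)%:R : 'F_p | n <- iota 0 p & (n ^ k == c %[mod p])%N].
have Feq (a b : nat) : (a%:R == b%:R :> 'F_p) = (a == b %[mod p])%N.
  rewrite -(inj_eq val_inj) /= !val_Fp_nat //.
have us : uniq s.
  rewrite map_inj_in_uniq ?filter_uniq ?iota_uniq // => a b.
  rewrite !mem_filter !mem_iota !add0n /= => /andP[_ ap] /andP[_ bp] /eqP.
  by rewrite Feq !modn_small // => /eqP.
have rs : all (root q) s.
  apply/allP => _ /mapP[n + ->]; rewrite mem_filter => /andP[nk _].
  by rewrite /root /q hornerD hornerN hornerXn hornerC subr_eq0 -natrX Feq.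
have qn0 : q != 0 by rewrite -size_poly_eq0 sq.
have := max_poly_roots qn0 rs us; rewrite sq ltnS; apply: leq_trans.
rewrite /natcount /index_iota subn0 size_map size_filter -sum1_count.
by rewrite [leqRHS]big_mkcond /=; apply: leq_sum => i _; case: ifP.
Qed.

Definition natdist (a b : nat) : nat := (a - b + (b - a))%N.

Lemma dvdn_natdist p a b : (p %| natdist a b)%N = (a == b %[mod p])%N.
Proof.
rewrite /natdist; have [ab|/ltnW ba] := leqP a b.
  have -> : (a - b = 0)%N by lia.
  by rewrite add0n eq_sym eqn_mod_dvd.
have -> : (b - a = 0)%N by lia.
by rewrite addn0 eqn_mod_dvd.
Qed.

(** The prime 2 divides [2 * _] for every residue, which gives 2 <= k residues. *)
Lemma natcount_dvd_diff_pow p k c : prime p -> (2 <= k)%N ->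
  periodic p (fun j => p %| 2 * natdist (j ^ k) c)%N /\
  (natcount p (fun j => p %| 2 * natdist (j ^ k) c)%N <= k)%N.
Proof.
move=> prp k2.
have E j : (p %| 2 * natdist (j ^ k) c)%N = (p == 2) || (j ^ k == c %[mod p])%N.
  by rewrite Euclid_dvdM // dvdn_natdist dvdn_prime2.
split=> [n|]; first by rewrite !E -modnXm modnDr modnXm.
rewrite /natcount; under eq_bigr do rewrite E.
case: eqP => [->|_] /=; first by rewrite sum_nat_const_nat.
by apply: natcount_kth_root => //; apply: ltnW.
Qed.

Lemma prod_le_exp (R : realType) (I : finType) (x : I -> R) :
  (forall i, 0 <= x i) -> \prod_i (1 + x i) <= expR (\sum_i x i).
Proof.
move=> x0; rewrite expR_sum; apply: ler_prod => i _.
by rewrite expR_ge1Dx andbT addr_ge0.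
Qed.

(** At a prime [i] the square has the factor [2 / i + 1 / i ^ 2 <= 3 / i]. *)
Lemma divisor_weight_sqr_le (R : realFieldType) (z w h : nat) : (w * w <= z)%N ->
  divisor_weight R z w h ^+ 2 <=
  \sum_(A : {set 'I_z.+1} | primeset (fun p => p %| 2 * h)%N z A)
    \prod_(i in A) (3 / i%:R).
Proof.
move=> wz; apply: le_trans (square_sum_le_union
   (E := primeset (fun p => p %| 2 * h)%N z) _ _) _.
- by move=> i; rewrite invr_ge0.
- move=> A B DA DB; have /primesetP[h1 h2] := primesetU DA DB.
  by apply/primesetP; split=> //; apply: leq_trans h2 wz.
apply: ler_sum => A /primesetP[prA _]; apply: ler_prod => i /prA[pri _].
have i1 : (1 : R) <= i%:R by rewrite (ler_nat _ 1) prime_gt0.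
have v1 : (i%:R : R)^-1 <= 1 by rewrite invf_le1; lra.
have v0 : (0 : R) <= i%:R^-1 by rewrite invr_ge0.
by move: (i%:R^-1) v0 v1 => v v0 v1; apply/andP; split; nra.
Qed.

(** Exchanging the sums, each squarefree modulus d <= w ^ 2 contributes its weight
    3 ^ r / d, where r is its number of prime factors, times the number of pairs
    (i, j) such that d divides 2 (i ^ k - j ^ k).  As d <= y, this number is at
    most 2 y ^ 2 k ^ r / d.  Extending the sum to all sets of primes, it is
    bounded by a convergent Euler product. *)
Lemma divisor_weight_average (R : realType) (k w y : nat) : (2 <= k)%N ->
  (0 < w)%N -> (w * w <= y)%N ->
  \sum_(i < y) \sum_(j < y) divisor_weight R (w * w) w (natdist (i ^ k) (j ^ k)) ^+ 2 <=
  2 * expR (6 * k%:R) * y%:R ^+ 2.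
Proof.
move=> k2 w0 wy; set z := (w * w)%N.
have z0 : (0 < z)%N by rewrite muln_gt0 w0.
suff H c : \sum_(j < y) divisor_weight R z w (natdist (j ^ k) c) ^+ 2 <=
    2 * expR (6 * k%:R) * y%:R.
  rewrite exchange_big /=; apply: le_trans (ler_sum _ (fun (j : 'I_y) _ => H (j ^ k)%N)) _.
  by rewrite sumr_const card_ord -[leLHS]mulr_natr expr2 !mulrA.
pose Q p j := (p %| 2 * natdist (j ^ k) c)%N.
apply: le_trans (ler_sum _ (fun (j : 'I_y) _ => divisor_weight_sqr_le R _ (leqnn z))) _.
have swap : \sum_(j < y)
    \sum_(A : {set 'I_z.+1} | primeset (fun p => Q p j) z A)
       \prod_(i in A) (3 / i%:R) =
   \sum_(A : {set 'I_z.+1} | primeset predT z A)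
     \prod_(i in A) (3 / i%:R) *
      (natcount y (fun j => [forall i in A, Q (i : nat) j]))%:R :> R.
  rewrite (exchange_big_dep (primeset predT z)) /=; last first.
    move=> j A _ /primesetP[prA Az]; apply/primesetP; split=> // i /prA[] //.
  apply: eq_bigr => A /primesetP[prA Az].
  rewrite natcount_card -sum1_card natr_sum mulr_sumr.
  under [RHS]eq_bigr do rewrite mulr1.
  apply: eq_bigl => j; rewrite inE; apply/primesetP/forall_inP => [[H _] i /H[]//|H].
  by split=> // i iA; split; [case: (prA i iA) | apply: H].
rewrite swap {swap}.
have term (A : {set 'I_z.+1}) : primeset predT z A ->
  (natcount y (fun j => [forall i in A, Q (i : nat) j]))%:R <=
    2 * y%:R * \prod_(i in A) (k%:R / i%:R) :> R.
  move=> /primesetP[prA Az].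
  have prA' i : i \in A -> prime i by case/prA.
  have perA (i : 'I_z.+1) : i \in A -> periodic i (Q i).
    by move=> /prA' pri; have [] := natcount_dvd_diff_pow c pri k2.
  have [per cnt] := natcount_primes prA' perA.
  have d0 := setprod_gt0 prA'.
  have := natcount_density R y d0 per.
  have sk : (natcount (setprod A) (fun n => [forall i in A, Q (i : nat) n])
      <= k ^ #|A|)%N.
    rewrite cnt -prod_nat_const; apply: leq_prod => i /prA' pri.
    by have [] := natcount_dvd_diff_pow c pri k2.
  have -> : \prod_(i in A) (k%:R / i%:R) = (k ^ #|A|)%:R / (setprod A)%:R :> R.
    by rewrite prodf_div -!natr_prod prod_nat_const.
  move: (natcount (setprod A) _) sk => s sk.
  move: (k ^ #|A|)%N sk => t sk; rewrite ler_norml => /andP[_].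
  rewrite lerBlDr => /le_trans; apply.
  have dR : (0 : R) < (setprod A)%:R by rewrite ltr0n.
  have dy : ((setprod A)%:R : R) <= y%:R.
    by rewrite ler_nat (leq_trans Az).
  have sR : (s%:R : R) <= t%:R by rewrite ler_nat.
  have s0 : (0 : R) <= s%:R by apply: ler0n.
  rewrite [leRHS]mulrA ler_pdivlMr // mulrDl mulrA divfK ?gt_eqF //.
  nra.
have prodle : \sum_(A : {set 'I_z.+1} | primeset predT z A)
    \prod_(i in A) (3 * k%:R / i%:R ^+ 2) <= expR (6 * k%:R) :> R.
  pose x (i : 'I_z.+1) : R := 3 * k%:R / i%:R ^+ 2.
  have x0 i : 0 <= x i by rewrite divr_ge0 ?mulr_ge0 ?exprn_ge0.
  apply: le_trans (_ : \sum_(A : {set 'I_z.+1} | A \subset setT) \prod_(i in A) x i <= _).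
    rewrite [leLHS]big_mkcond [leRHS]big_mkcond /=; apply: ler_sum => A _.
    by rewrite subsetT; case: ifP => // _; apply: prodr_ge0.
  rewrite sum_subset_prod; under eq_bigl do rewrite inE.
  apply: le_trans (prod_le_exp x0) _; rewrite ler_expR -mulr_sumr.
  have := sum_inv_squares_le2 R z; have := ler0n R k.
  by move: (\sum_(_ < _) _) => S k0 S2; nra.
apply: le_trans (_ : 2 * y%:R *
   \sum_(A : {set 'I_z.+1} | primeset predT z A)
     \prod_(i in A) (3 * k%:R / i%:R ^+ 2) <= _); last first.
  by rewrite [leRHS]mulrAC ler_wpM2l // mulr_ge0.
rewrite mulr_sumr; apply: ler_sum => A DA.
have p0 : 0 <= \prod_(i in A) (3 / i%:R : R).
  by apply: prodr_ge0 => i _; rewrite divr_ge0.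
apply: le_trans (ler_wpM2l p0 (term A DA)) _.
rewrite mulrCA -big_split /= ler_wpM2l ?mulr_ge0 // le_eqVlt; apply/orP; left.
apply/eqP/eq_bigr => i iA; have /primesetP[/(_ i iA)[/prime_gt0 i0 _] _] := DA.
by field; rewrite pnatr_eq0 -lt0n.
Qed.

(** * A lower bound of Chebyshev *)

(** In Legendre's formula the term of index [k] is [2 n %/ p ^ k] minus twice
    [n %/ p ^ k], which is at most 1, and it vanishes when [p ^ k > 2 n]. *)
Lemma logn_central_bin p n : prime p ->
  (logn p 'C(n.*2, n) <= trunc_log p n.*2)%N.
Proof.
move=> prp; set L := trunc_log p n.*2.
have p1 := prime_gt1 prp.
have C0 : (0 < 'C(n.*2, n))%N by rewrite bin_gt0 -addnn leq_addr.
have factE : logn p (n.*2)`! = (logn p 'C(n.*2, n) + (logn p n`! + logn p n`!))%N.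
  have nn : (n <= n.*2)%N by rewrite -addnn leq_addr.
  rewrite -(bin_fact nn) lognM ?muln_gt0 ?fact_gt0 // lognM ?fact_gt0 //.
  by congr (_ + (_ + logn p _`!))%N; rewrite -addnn addnK.
have ext : logn p n`! = (\sum_(1 <= k < (n.*2).+1) n %/ p ^ k)%N.
  rewrite logn_fact // [RHS](@big_cat_nat _ _ _ n.+1) //=; last by lia.
  rewrite [X in (_ + X)%N]big_nat_cond [X in (_ + X)%N]big1 ?addn0 // => k /andP[/andP[nk _] _].
  by rewrite divn_small // (ltn_trans nk) // ltn_expl.
have main : (\sum_(1 <= k < (n.*2).+1) n.*2 %/ p ^ k <=
    \sum_(1 <= k < (n.*2).+1) (k <= L)%N +
    (\sum_(1 <= k < (n.*2).+1) n %/ p ^ k + \sum_(1 <= k < (n.*2).+1) n %/ p ^ k))%N.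
  rewrite -!big_split /= big_nat_cond [leqRHS]big_nat_cond; apply: leq_sum => k /andP[/andP[k1 k2] _].
  have [kL|Lk] := leqP k L.
    have pk0 : (0 < p ^ k)%N by rewrite expn_gt0 prime_gt0.
    rewrite -ltnS ltn_divLR // -[n.*2]addnn.
    have := ltn_ceil n pk0; move: (n %/ p ^ k)%N (p ^ k)%N => a b; nia.
  rewrite divn_small //; apply: leq_trans (trunc_log_ltn _ p1) _.
  by rewrite leq_pexp2l // prime_gt0.
have L1 : (\sum_(1 <= k < (n.*2).+1) (k <= L)%N <= L)%N.
  suff -> M : (\sum_(1 <= k < M.+1) (k <= L)%N)%N = minn M L by rewrite geq_minr.
  elim: M => [|M IH]; first by rewrite big_geq // min0n.
  by rewrite big_nat_recr //= IH; case: (leqP M.+1 L) => ?; lia.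
by move: main L1; rewrite -logn_fact // -ext factE; lia.
Qed.

(** Each prime power dividing the binomial coefficient exactly is at most [2 n]. *)
Lemma central_bin_le_exp_pi n : (0 < n)%N ->
  ('C(n.*2, n) <= n.*2 ^ natcount (n.*2).+1 prime)%N.
Proof.
move=> n0.
have C0 : (0 < 'C(n.*2, n))%N by rewrite bin_gt0 -addnn leq_addr.
have nn : (0 < n.*2)%N by rewrite double_gt0.
rewrite {1}(prod_prime_decomp C0) prime_decompE big_map /=.
apply: (@leq_trans (\prod_(p <- primes 'C(n.*2, n)) n.*2)).
  rewrite big_seq [leqRHS]big_seq; apply: leq_prod => p.
  rewrite mem_primes => /andP[prp _].
  apply: leq_trans (trunc_logP (prime_gt1 prp) nn).
  by rewrite leq_pexp2l ?prime_gt0 // logn_central_bin.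
rewrite big_const_seq count_predT iter_muln_1 leq_pexp2l //.
have -> : natcount (n.*2).+1 prime = size [seq p <- iota 0 (n.*2).+1 | prime p].
  rewrite /natcount /index_iota subn0 size_filter -sum1_count [RHS]big_mkcond.
  by apply: eq_bigr => p _; case: (prime p).
apply: uniq_leq_size; first exact: primes_uniq.
move=> p pC; have prp : prime p by move: pC; rewrite mem_primes => /andP[].
rewrite mem_filter prp mem_iota /= add0n ltnS.
apply: leq_trans (trunc_logP (prime_gt1 prp) nn).
rewrite -[X in (X <= _)%N]expn1 leq_pexp2l ?(prime_gt0 prp) //.
by apply: leq_trans _ (logn_central_bin n prp); rewrite logn_gt0.
Qed.

Lemma exp2_le_central_bin n : (2 ^ n <= 'C(n.*2, n))%N.
Proof.
elim: n => [//|n IH].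
have h1 : ('C(n.*2, n) <= 'C((n.*2).+1, n.+1))%N by rewrite binS leq_addl.
have h2 : ('C(n.*2, n) <= 'C((n.*2).+1, n))%N.
  by case: (n) => // m; rewrite binS leq_addr.
by rewrite doubleS binS expnS; lia.
Qed.

(** * First and second moments *)

(** Since [ln (1 + 1 / n) <= 1 / n]. *)
Lemma ln_le_harmonic (R : realType) (w : nat) :
  ln (w.+1%:R : R) <= \sum_(1 <= n < w.+1) n%:R^-1.
Proof.
elim: w => [|w IH]; first by rewrite ln1 big_geq.
rewrite big_nat_recr //=; apply: le_trans (lerD IH (lexx _)).
have w0 : (0 : R) < w.+1%:R by rewrite ltr0n.
have -> : (w.+2%:R : R) = w.+1%:R * (1 + w.+1%:R^-1).
  by rewrite mulrDr mulr1 divff ?gt_eqF // natr1.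
rewrite lnM ?posrE ?addr_gt0 ?invr_gt0 // lerD2l le_ln1Dx //.
by apply: lt_trans (_ : 0 < _); rewrite ?invr_gt0 // ltrN10.
Qed.

(** The sieve with [z = w ^ 2], where the remainder [z + 1 + z ^ 6] is at most twice
    [w ^ 12].  For [h = 0] no prime is sieved, and the bound is trivial. *)
Lemma prime_pair_count_le (R : realType) (w h N : nat) : (2 <= w)%N ->
  #|[set n : 'I_N | prime n && prime (n + h)%N]|%:R <=
  2 * (w%:R : R) ^+ 12 +
  4 * N%:R / ln w%:R ^+ 2 * divisor_weight R (w * w) w h ^+ 2.
Proof.
move=> w2; set z := (w * w)%N.
have w0 : (0 < w)%N by apply: ltnW.
have z0 : (0 < z)%N by rewrite muln_gt0 w0.
have wR : (2 : R) <= w%:R by rewrite (ler_nat _ 2).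
apply: le_trans (prime_pair_sieve R h N z0) _.
set G := \sum_(A | _) _.
rewrite addrAC; apply: lerD.
  rewrite -natr1 natrM; have t4 : (4 : R) <= w%:R * w%:R by nra.
  have -> : (w%:R : R) ^+ 12 = (w%:R * w%:R) ^+ 6 by ring.
  move: (_ * _) t4 => t t4; have h1 : t ^+ 2 <= t ^+ 6 by apply: ler_weXn2l => //; lra.
  have h2 : t + 1 <= t ^+ 2 by nra.
  lra.
have L0 : 0 < ln (w%:R : R) by rewrite ln_gt0 //; lra.
have F1 := divisor_weight_ge1 R z h w0.
have HG := sieve_sum_ge R h (leqnn z).
have LG : ln (w%:R : R) ^+ 2 <= 4 * divisor_weight R z w h ^+ 2 * G.
  apply: le_trans HG; rewrite ler_pXn2r ?nnegrE ?(ltW L0) //.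
    apply: le_trans (ln_le_harmonic R w); rewrite ler_ln ?posrE ?ltr0n //.
    by rewrite ler_nat.
  by apply: sumr_ge0 => n _; rewrite invr_ge0.
have L20 : 0 < ln (w%:R : R) ^+ 2 by rewrite exprn_gt0.
have G0 : 0 < G.
  have f0 : 0 < 4 * divisor_weight R z w h ^+ 2 by rewrite mulr_gt0 ?exprn_gt0 //; lra.
  by rewrite -(pmulr_rgt0 _ f0); apply: lt_le_trans LG.
rewrite ler_pdivrMr //.
have -> : 4 * N%:R / ln w%:R ^+ 2 * divisor_weight R z w h ^+ 2 * G =
  N%:R * ((4 * divisor_weight R z w h ^+ 2 * G) / ln w%:R ^+ 2) by field; rewrite gt_eqF.
by rewrite ler_peMr // ler_pdivlMr // mul1r.
Qed.

(** Comparing the bounds [2 ^ n] and [X ^ natcount X.+1 prime] for the central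
    binomial coefficient with [n] the half of [X]. *)
Lemma prime_count_ge (R : realType) (X : nat) : (2 <= X)%N ->
  X%:R * (ln 2 / 4) <= (natcount X.+1 prime)%:R * ln (X%:R : R).
Proof.
move=> X2; set n := X./2.
have n0 : (0 < n)%N by rewrite half_gt0.
have nX : (n.*2 <= X)%N by rewrite /n; lia.
have Xn : (X <= n * 4)%N by rewrite /n; lia.
have h : (2 ^ n <= X ^ natcount X.+1 prime)%N.
  apply: leq_trans (exp2_le_central_bin n) _; apply: leq_trans (central_bin_le_exp_pi n0) _.
  apply: leq_trans (_ : X ^ natcount (n.*2).+1 prime <= _)%N.
    by case: (natcount _ _) => // m; rewrite leq_exp2r.
  by rewrite leq_pexp2l ?natcount_le // ltnW.
have : ln ((2 ^ n)%:R : R) <= ln (X ^ natcount X.+1 prime)%:R.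
  by rewrite ler_ln ?posrE ?ltr0n ?expn_gt0 ?(ltnW X2) // ler_nat.
rewrite !natrX !lnXn ?ltr0n ?(ltnW X2) // -!(mulr_natl (ln _)).
apply: le_trans.
have l2 : 0 <= ln (2 : R) by rewrite ln_ge0 //; lra.
have : (X%:R : R) <= n%:R * 4 by rewrite -natrM ler_nat.
by move: (ln 2) l2 => l l0 ?; nra.
Qed.

Definition bounded_reps (X y k n : nat) : {set 'I_X.+1 * 'I_y.+1} :=
  [set q : 'I_X.+1 * 'I_y.+1 | [&& prime q.1, (0 < q.2)%N & (q.1 + q.2 ^ k == n)%N]].

Lemma sum_card_bounded_reps (X y k : nat) : (y ^ k <= X)%N ->
  (\sum_(n < X.*2.+1) #|bounded_reps X y k n| = natcount X.+1 prime * y)%N.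
Proof.
move=> yX.
under eq_bigr do rewrite -sum1_card big_mkcond.
rewrite exchange_big /=.
transitivity (\sum_(q : 'I_X.+1 * 'I_y.+1) (prime q.1 : nat) * (0 < q.2 : nat))%N.
  apply: eq_bigr => -[p j] _ /=.
  have pj : (p + j ^ k < X.*2.+1)%N.
    have := ltn_ord p; have := ltn_ord j; rewrite !ltnS => jy pX.
    by rewrite -addnn leq_add // (leq_trans _ yX) //; case: (k) => // m; rewrite leq_exp2r.
  rewrite (bigD1 (Ordinal pj)) //= big1 ?addn0 => [|n].
    by rewrite inE /= eqxx andbT; case: (prime p); case: (0 < j)%N.
  rewrite -val_eqE inE /= eq_sym => /negbTE ->; by rewrite !andbF.
rewrite -(pair_bigA _ (fun (p : 'I_X.+1) (j : 'I_y.+1) => (prime p : nat) * (0 < j : nat))%N) /=.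
rewrite -big_distrlr /= /natcount big_mkord; congr (_ * _)%N.
by rewrite big_ord_recl /= sum_nat_const card_ord muln1.
Qed.

(** Two representations of the same [n] with fixed [i] and [j] give two primes that
    differ by the distance of the two powers; the smaller prime determines both. *)
Lemma sum_sqr_card_bounded_reps (X y k : nat) :
  (\sum_(n < X.*2.+1) #|bounded_reps X y k n| ^ 2 <=
   \sum_(i < y.+1) \sum_(j < y.+1)
     #|[set n : 'I_X.+1 | prime n && prime (n + natdist (i ^ k) (j ^ k))]|)%N.
Proof.
pose C (q q' : 'I_X.+1 * 'I_y.+1) :=
  [&& prime q.1, prime q'.1 & (q.1 + q.2 ^ k == q'.1 + q'.2 ^ k)%N].
apply: (@leq_trans (\sum_q \sum_q' C q q')).
  have E n : (#|bounded_reps X y k n| ^ 2 =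
     \sum_q \sum_q' (q \in bounded_reps X y k n) * (q' \in bounded_reps X y k n))%N.
    rewrite -big_distrlr /= -mulnn -sum1_card big_mkcond /=.
    by congr (_ * _)%N; apply: eq_bigr => q _; case: ifP.
  rewrite (eq_bigr _ (fun (n : 'I_X.*2.+1) _ => E n)).
  rewrite exchange_big /=; apply: leq_sum => q _.
  rewrite exchange_big /=; apply: leq_sum => q' _.
  have [Cq|nC] := boolP (C q q'); last first.
    rewrite big1 // => n _; rewrite !inE.
    apply/eqP; rewrite muln_eq0 !eqb0 -negb_and; apply: contra nC.
    by move=> /andP[/and3P[h1 _ /eqP h2] /and3P[h3 _ /eqP h4]]; rewrite /C h1 h3 h2 h4 /=.
  have [lt|ge] := ltnP (q.1 + q.2 ^ k) X.*2.+1.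
    rewrite (bigD1 (Ordinal lt)) //= big1 => [|n].
      by rewrite addn0; case: (_ \in _); case: (_ \in _).
    rewrite -val_eqE /= !inE eq_sym => /negbTE ->; by rewrite !andbF.
  rewrite big1 // => n _; rewrite !inE.
  have -> : (q.1 + q.2 ^ k == n)%N = false by apply/negbTE; have := ltn_ord n; lia.
  by rewrite !andbF.
rewrite -(pair_bigA _ (fun p i => \sum_q' C (p, i) q'))%N exchange_big /=.
apply: leq_sum => i _.
under eq_bigr do rewrite -(pair_bigA _ (fun p' j => (C (_, i) (p', j) : nat))) exchange_big /=.
rewrite exchange_big /=; apply: leq_sum => j _; rewrite pair_bigA /=.
have -> : (\sum_(p : 'I_X.+1 * 'I_X.+1) C (p.1, i) (p.2, j) =
    #|[set p : 'I_X.+1 * 'I_X.+1 | C (p.1, i) (p.2, j)]|)%N.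
  rewrite -sum1_card [RHS]big_mkcond /=; apply: eq_bigr => p _.
  by rewrite inE; case: (C _ _).
rewrite -(card_in_imset (f := fun p : 'I_X.+1 * 'I_X.+1 =>
   if (i ^ k <= j ^ k)%N then p.2 else p.1)); last first.
  move=> [p p'] [q q']; rewrite !inE /C /= => /and3P[_ _ /eqP e1] /and3P[_ _ /eqP e2].
  by case: leqP => _ e; congr (_, _) => //; apply/val_inj => /=; move: e1 e2; rewrite e; lia.
apply: subset_leq_card; apply/subsetP => n /imsetP[[p p']].
rewrite !inE /C /natdist /= => /and3P[prp prp' /eqP e] ->.
case: leqP => ij.
  rewrite prp' /=; suff -> : (p' + (i ^ k - j ^ k + (j ^ k - i ^ k)) = p)%N by [].
  lia.
rewrite prp /=; suff -> : (p + (i ^ k - j ^ k + (j ^ k - i ^ k)) = p')%N by [].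
lia.
Qed.

(** * Small second moment forces many large values *)

Lemma sum_sqr_le (R : realFieldType) (T : finType) (A : {set T}) (f : T -> R) :
  (\sum_(i in A) f i) ^+ 2 <= #|A|%:R * \sum_(i in A) f i ^+ 2.
Proof.
have [A0|A0] := posnP #|A|.
  by move/eqP: A0; rewrite cards_eq0 => /eqP ->; rewrite !big_set0 expr0n mulr0.
set S := \sum_(i in A) f i; set Q := \sum_(i in A) f i ^+ 2.
have c0 : (0 : R) < #|A|%:R by rewrite ltr0n.
have : 0 <= \sum_(i in A) (#|A|%:R * f i - S) ^+ 2.
  by apply: sumr_ge0 => i _; apply: sqr_ge0.
have -> : \sum_(i in A) (#|A|%:R * f i - S) ^+ 2 =
   #|A|%:R * (#|A|%:R * Q - S ^+ 2).
  transitivity (\sum_(i in A) (#|A|%:R ^+ 2 * f i ^+ 2 - 2 * #|A|%:R * S * f i + S ^+ 2)).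
    by apply: eq_bigr => i _; ring.
  rewrite big_split sumrB /= -!mulr_sumr -/S -/Q sumr_const -[_ *+ #|_|]mulr_natl.
  by ring.
by rewrite pmulr_rge0 // subr_ge0.
Qed.

(** The terms below [t] contribute at most half of the sum, so the others
    contribute at least [S1]; the Cauchy-Schwarz inequality then bounds their
    number from below. *)
Lemma card_ge_of_second_moment (R : realFieldType) (T : finType) (f : T -> R) (t S1 S2 : R) :
  (forall i, 0 <= f i) -> 0 <= t -> 0 <= S1 -> #|T|%:R * t <= S1 ->
  2 * S1 <= \sum_i f i -> \sum_i f i ^+ 2 <= S2 ->
  S1 ^+ 2 <= #|[set i | t <= f i]|%:R * S2.
Proof.
move=> f0 t0 S0 tS H1 H2; set A := [set i | t <= f i].
have hA : S1 <= \sum_(i in A) f i.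
  have : \sum_i f i <= \sum_(i in A) f i + #|T|%:R * t.
    rewrite (bigID (mem A)) /= lerD2l.
    apply: le_trans (_ : \sum_(i | i \notin A) t <= _).
      by apply: ler_sum => i; rewrite inE -ltNge => /ltW.
    by rewrite sumr_const -[t *+ _]mulr_natl ler_wpM2r // ler_nat max_card.
  lra.
apply: le_trans (_ : (\sum_(i in A) f i) ^+ 2 <= _).
  by rewrite ler_pXn2r ?nnegrE // (le_trans S0).
apply: le_trans (sum_sqr_le _ _) _; rewrite ler_wpM2l //.
apply: le_trans H2; rewrite [leRHS](bigID (mem A)) /= lerDl.
by apply: sumr_ge0 => i _; apply: sqr_ge0.
Qed.

(** * Many integers with many representations *)

Lemma size_le_fset_set (T : choiceType) (A : classical_sets.set T) (s : seq T) :
  finite_set A -> uniq s -> (forall x, x \in s -> A x) ->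
  (size s <= #|` fset_set A|)%N.
Proof.
move=> finA us sA; apply: uniq_leq_size => // x xs.
by rewrite in_fset_set //; apply/mem_set/sA.
Qed.

Lemma card_bounded_reps_le (X y k n : nat) : (0 < k)%N ->
  (#|bounded_reps X y k n| <= repr_count k n)%N.
Proof.
move=> k0; rewrite cardE /repr_count.
rewrite -(size_map (fun q : 'I_X.+1 * 'I_y.+1 => (q.1 : nat, q.2 : nat))).
apply: size_le_fset_set; first exact: finite_representations.
  rewrite map_inj_uniq ?enum_uniq // => -[a b] [c d] /= [ac bd].
  by congr (_, _); apply/val_inj.
move=> _ /mapP[q + ->]; rewrite mem_enum inE => /and3P[h1 h2 /eqP h3].
by split.
Qed.

(** The sieve bound is summed over all pairs (i, j), the diagonal included.  The
    remainder [w ^ 12] is absorbed because [ln w <= w] and [w ^ 14 <= X]. *)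
Lemma second_moment_le (R : realType) (X y k w : nat) : (2 <= k)%N ->
  (2 <= w)%N -> (0 < y)%N -> (w * w <= y.+1)%N -> (w ^ 14 <= X)%N ->
  (\sum_(n < X.*2.+1) #|bounded_reps X y k n| ^ 2)%:R <=
  72 * expR (6 * k%:R) * y%:R ^+ 2 * X%:R / ln (w%:R : R) ^+ 2.
Proof.
move=> k2 w2 y_gt0 wwy wX14; pose e : R := expR (6 * k%:R).
have e1 : 1 <= e by rewrite -expR0 ler_expR mulr_ge0.
have w0 : (0 < w)%N by apply: ltnW.
have wR : (2 : R) <= w%:R by rewrite (ler_nat _ 2).
set L : R := ln w%:R.
have L0 : 0 < L by rewrite ln_gt0 //; lra.
have Lw : L <= w%:R by apply: ltW; apply: ln_sublinear; lra.
have wX : (w%:R : R) ^+ 14 <= X%:R by rewrite -natrX ler_nat.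
have X1 : (1 : R) <= X%:R.
  by rewrite (ler_nat _ 1) (leq_trans _ wX14) // expn_gt0 w0.
have y1 : (1 : R) <= y%:R by rewrite (ler_nat _ 1).
apply: le_trans (_ : (\sum_(i < y.+1) \sum_(j < y.+1)
   #|[set n : 'I_X.+1 | prime n && prime (n + natdist (i ^ k) (j ^ k))]|)%:R <= _).
  by rewrite ler_nat sum_sqr_card_bounded_reps.
rewrite natr_sum.
apply: le_trans (_ : \sum_(i < y.+1) \sum_(j < y.+1)
  (2 * w%:R ^+ 12 + 4 * X.+1%:R / L ^+ 2 *
   divisor_weight R (w * w) w (natdist (i ^ k) (j ^ k)) ^+ 2) <= _).
  apply: ler_sum => i _; rewrite natr_sum; apply: ler_sum => j _.
  exact: prime_pair_count_le.
under eq_bigr do rewrite big_split sumr_const card_ord /= -mulr_sumr.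
rewrite big_split sumr_const card_ord /= -mulr_sumr.
have av := divisor_weight_average R k2 w0 wwy.
apply: le_trans (lerD (lexx _) (ler_wpM2l _ av)) _.
  by apply: divr_ge0; [rewrite mulr_ge0 | apply: sqr_ge0].
rewrite -/e -mulrnA -[_ *+ (y.+1 * y.+1)]mulr_natl natrM.
have L20 : 0 < L ^+ 2 by rewrite exprn_gt0.
have y2 : (y.+1%:R : R) <= 2 * y%:R by rewrite -natr1; lra.
have x2 : (X.+1%:R : R) <= 2 * X%:R by rewrite -natr1; lra.
have w12 : (w%:R : R) ^+ 12 <= X%:R / L ^+ 2.
  rewrite ler_pdivlMr //; apply: le_trans wX.
  have -> : (w%:R : R) ^+ 14 = w%:R ^+ 12 * w%:R ^+ 2 by rewrite -exprD.
  by rewrite ler_wpM2l ?exprn_ge0 // ler_pXn2r ?nnegrE // ltW.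
have ysq : (y.+1%:R : R) ^+ 2 <= 4 * y%:R ^+ 2.
  have -> : 4 * y%:R ^+ 2 = (2 * y%:R) ^+ 2 :> R by ring.
  by rewrite ler_pXn2r ?nnegrE // mulr_ge0.
set Y : R := y.+1%:R ^+ 2 in ysq *.
have Y0 : 0 <= Y by rewrite exprn_ge0.
have -> : 72 * e * y%:R ^+ 2 * X%:R / L ^+ 2 =
    18 * e * (4 * y%:R ^+ 2) * (X%:R / L ^+ 2).
  by field; rewrite gt_eqF.
set u := X%:R / L ^+ 2 in w12 *.
have u0 : 0 <= u by rewrite divr_ge0 // ltW.
have -> : y.+1%:R * y.+1%:R * (2 * w%:R ^+ 12) = 2 * Y * w%:R ^+ 12 :> R.
  by rewrite /Y; ring.
have xu : X.+1%:R / L ^+ 2 <= 2 * u.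
  by rewrite /u mulrA ler_wpM2r // invr_ge0 ltW.
apply: le_trans (_ : 18 * e * Y * u <= _); last first.
  by rewrite ler_wpM2r // ler_wpM2l //; lra.
apply: le_trans (_ : 2 * Y * u + 16 * e * Y * u <= _); last first.
  have -> : 18 * e * Y * u = 2 * Y * u + 16 * e * Y * u + 2 * ((e - 1) * (Y * u)).
    by ring.
  by rewrite lerDl mulr_ge0 // mulr_ge0 ?subr_ge0 // mulr_ge0.
apply: lerD; first by rewrite ler_wpM2l // mulr_ge0.
have -> : 4 * X.+1%:R / L ^+ 2 * (2 * e * Y) = 8 * e * Y * (X.+1%:R / L ^+ 2).
  by field; rewrite gt_eqF.
have -> : 16 * e * Y * u = 8 * e * Y * (2 * u) by ring.
by rewrite ler_wpM2l // !mulr_ge0 //; lra.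
Qed.

(** The exponent 7 is the least for which [X = w ^ (7 * k)] is at least [w ^ 14] for
    every [k >= 2], as the remainder of the sieve requires; then also
    [w ^ 2 <= y = w ^ 7]. *)
Lemma many_represented (R : realType) (k : nat) : (2 <= k)%N ->
  exists a b : R, [/\ 0 < a, 0 < b & forall w, (2 <= w)%N ->
    b * (w ^ (7 * k))%:R <=
    #|[set n : 'I_(w ^ (7 * k)).*2.+1 |
        a * w%:R ^+ 7 / ln w%:R <= (repr_count k n)%:R]|%:R].
Proof.
move=> k2; pose e : R := expR (6 * k%:R).
have e1 : 1 <= e by rewrite -expR0 ler_expR mulr_ge0.
pose l : R := ln 2.
have l0 : 0 < l by rewrite ln_gt0 //; lra.
pose c : R := l / (28 * k%:R).
have kR : (2 : R) <= k%:R by rewrite (ler_nat _ 2).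
have c0 : 0 < c by rewrite divr_gt0 // mulr_gt0; lra.
(* c * X / ln w bounds the number of primes up to X from below, as
   ln X = 7 * k * ln w; there are at most 3 * X integers up to 2 * X, so the
   threshold (c / 6) * y / ln w leaves at least half of the first moment. *)
exists (c / 6), (c ^+ 2 / (4 * (72 * e))); split.
- by rewrite divr_gt0.
- by rewrite divr_gt0 ?exprn_gt0 // !mulr_gt0; lra.
move=> w w2.
have [X XE] : {X | X = (w ^ (7 * k))%N} by exists (w ^ (7 * k))%N.
have [y yE] : {y | y = (w ^ 7)%N} by exists (w ^ 7)%N.
rewrite -XE.
have w0 : (0 < w)%N by apply: ltnW.
have yX : (y ^ k)%N = X by rewrite yE XE -expnM.
have k0 : (0 < k)%N by apply: ltnW.
have wR : (2 : R) <= w%:R by rewrite (ler_nat _ 2).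
set L : R := ln w%:R.
have L0 : 0 < L by rewrite ln_gt0 //; lra.
have yR : (y%:R : R) = w%:R ^+ 7 by rewrite yE natrX.
have XR : (X%:R : R) = w%:R ^+ (7 * k) by rewrite XE natrX.
have X2 : (2 <= X)%N.
  by apply: leq_trans w2 _; rewrite XE -[X in (X <= _)%N]expn1 leq_pexp2l //; lia.
have X3 : (X.*2.+1 <= 3 * X)%N by move: X2; clear; lia.
have X0 : (0 : R) < X%:R by rewrite ltr0n ltnW.
have y0 : (0 < y)%N by rewrite yE expn_gt0 w0.
have y1 : (1 : R) <= y%:R by rewrite (ler_nat _ 1).
have wX : (w ^ 14 <= X)%N by rewrite XE leq_pexp2l //; lia.
have wwy : (w * w <= y.+1)%N.
  by apply: leqW; rewrite yE mulnn leq_pexp2l.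
pose f (n : 'I_X.*2.+1) : R := #|bounded_reps X y k n|%:R.
pose S1 : R := c * X%:R * y%:R / (2 * L).
pose t : R := c * y%:R / (6 * L).
pose S2 : R := 72 * e * y%:R ^+ 2 * X%:R / L ^+ 2.
have t0 : 0 <= t by rewrite divr_ge0 ?mulr_ge0 //; lra.
have S10 : 0 <= S1 by rewrite divr_ge0 ?mulr_ge0 //; lra.
have tS : #|'I_X.*2.+1|%:R * t <= S1.
  have -> : S1 = 3 * X%:R * t by rewrite /S1 /t; field; lra.
  by rewrite card_ord ler_wpM2r // -natrM ler_nat.
have H1 : 2 * S1 <= \sum_i f i.
  rewrite /f -natr_sum sum_card_bounded_reps ?yX // natrM.
  have -> : 2 * S1 = (c * X%:R / L) * y%:R by rewrite /S1; field; lra.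
  rewrite ler_wpM2r // ler_pdivrMr //.
  have := prime_count_ge R X2.
  have -> : ln (X%:R : R) = (7 * k%:R) * L.
    by rewrite XR lnXn; [rewrite -[_ *+ (7 * k)]mulr_natl natrM | lra].
  rewrite -/l => H.
  have k7 : 0 < 7 * k%:R :> R by lra.
  rewrite -(ler_pM2r k7); apply: le_trans (_ : X%:R * (l / 4) <= _).
    by rewrite le_eqVlt; apply/orP; left; apply/eqP; rewrite /c; field; lra.
  by apply: le_trans H _; rewrite le_eqVlt; apply/orP; left; apply/eqP; ring.
have H2 : \sum_i f i ^+ 2 <= S2.
  have -> : \sum_i f i ^+ 2 = (\sum_(n < X.*2.+1) #|bounded_reps X y k n| ^ 2)%:R.
    by rewrite natr_sum; apply: eq_bigr => n _; rewrite natrX.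
  exact: second_moment_le.
have f0 i : 0 <= f i by apply: ler0n.
have := card_ge_of_second_moment f0 t0 S10 tS H1 H2.
have S20 : 0 < S2 by rewrite divr_gt0 ?mulr_gt0 ?exprn_gt0 //; lra.
rewrite -ler_pdivrMr // => /le_trans HH.
have -> : c ^+ 2 / (4 * (72 * e)) * X%:R = S1 ^+ 2 / S2.
  by rewrite /S1 /S2; field; rewrite !gt_eqF //; lra.
apply: HH; rewrite ler_nat; apply: subset_leq_card; apply/subsetP => n.
rewrite !inE /t /f yR => tn.
have -> : c / 6 * w%:R ^+ 7 / L = c * w%:R ^+ 7 / (6 * L) by field; lra.
by apply: le_trans tn _; rewrite ler_nat card_bounded_reps_le.
Qed.

(** * Passing to a real bound *)

Lemma ex_power_scale (R : realType) (K : nat) (x : R) : (0 < K)%N -> 3 <= x ->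
  exists w, [/\ (1 <= w)%N, 2 * (w ^ K)%:R <= x & x < 2 * (w.+1 ^ K)%:R].
Proof.
move=> K0 x3; have x0 : 0 <= x by lra.
pose P w := (2 * w ^ K <= Num.truncn x)%N.
have PE w : P w = (2 * (w ^ K)%:R <= x) by rewrite /P truncn_ge_nat // natrM.
have P1 : P 1%N by rewrite PE exp1n; lra.
have Pb w : P w -> (w <= Num.truncn x)%N.
  apply: leq_trans; apply: (@leq_trans (w ^ K)); last by rewrite leq_pmull.
  by case: w => // w; rewrite -[X in (X <= _)%N]expn1 leq_pexp2l.
case: (ex_maxnP (ex_intro P 1%N P1) Pb) => w Pw wmax; exists w; split.
- exact: wmax.
- by rewrite -PE.
- by rewrite ltNge -PE; apply/negP => /wmax; rewrite ltnn.
Qed.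

Lemma count_upto_sub (R : realType) (x : R) (P Q : nat -> Prop) :
  (forall n, P n -> Q n) -> (count_upto x P <= count_upto x Q)%N.
Proof.
move=> PQ; apply: fsubset_leq_card; rewrite -fset_set_sub; try exact: finite_upto.
by move=> n [h1 h2 /PQ h3]; split.
Qed.

Lemma repr_count_gt0 (k n : nat) : (0 < repr_count k n)%N ->
  exists p j : nat, [/\ prime p, (0 < j)%N & (p + j ^ k)%N = n].
Proof.
rewrite /repr_count cardfs_gt0 => /fset0Pn[[p j]].
have [finA|nfin] := pselect (finite_set (representations k n)).
  by rewrite in_fset_set // => /set_mem [h1 h2 h3]; exists p, j.
by rewrite /fset_set; case: pselect.
Qed.

Theorem corollary1p2 (R : realType) (k : nat) (hk : (2 <= k)%N) :
  exists c1 c2 : R,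
    [/\ 0 < c1, 0 < c2 &
      forall x : R, 3 <= x ->
        c2 * x <= (count_upto x
                     (fun n => c1 * (x `^ (k%:R^-1) / ln x)
                               <= (repr_count k n)%:R))%:R
        /\
        c2 * x <= (count_upto x
                     (fun n => exists p j : nat,
                        [/\ prime p, (0 < j)%N & (p + j ^ k)%N = n]))%:R].
Proof.
have [a [b [a0 b0 Hab]]] := many_represented R hk.
have [K KE] : {K | K = (7 * k)%N} by exists (7 * k)%N.
rewrite -KE in Hab.
(* B absorbs the ratio of x to w ^ K: x < 2 * (w + 1) ^ K <= 2 * (2 * w) ^ K. *)
have [B BE] : {B : R | B = 2 ^+ K.+1} by exists (2 ^+ K.+1).
have k0 : (0 < k)%N by apply: ltnW.
have K0 : (0 < K)%N by rewrite KE muln_gt0 k0.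
have B1 : 1 <= B by rewrite BE; apply: exprn_ege1; lra.
pose l : R := ln 2.
have l0 : 0 < l by rewrite ln_gt0 //; lra.
pose c1 := Num.min a l / B; pose c2 := Num.min 1 b / B.
have c1_gt0 : 0 < c1 by rewrite divr_gt0 ?lt_min ?a0 //; lra.
have c2_gt0 : 0 < c2 by rewrite divr_gt0 ?lt_min ?b0 //; lra.
exists c1, c2; split=> // x x3.
pose P1 n := c1 * (x `^ k%:R^-1 / ln x) <= (repr_count k n)%:R.
suff main : c2 * x <= (count_upto x P1)%:R.
  split=> //; apply: le_trans main _; rewrite ler_nat; apply: count_upto_sub.
  move=> n Pn; apply: repr_count_gt0; rewrite -(ltr0n R); apply: lt_le_trans Pn.
  by rewrite mulr_gt0 // divr_gt0 ?powR_gt0 ?ln_gt0 //; lra.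
have [w [w1 wx xw]] := ex_power_scale K0 x3.
have wR : (1 : R) <= w%:R by rewrite (ler_nat _ 1).
have xB : x <= B * w%:R ^+ K.
  apply/ltW/(lt_le_trans xw); rewrite BE exprS -mulrA ler_wpM2l // -exprMn natrX.
  by rewrite ler_pXn2r ?nnegrE ?mulr_ge0 // -natr1; lra.
have rootx : x `^ k%:R^-1 <= B * w%:R ^+ 7.
  have B0 : 0 <= B * w%:R ^+ 7 by rewrite mulr_ge0 ?exprn_ge0 //; lra.
  have xk : x <= (B * w%:R ^+ 7) `^ k%:R.
    rewrite powR_mulrn // exprMn -exprM -KE; apply: le_trans xB _.
    rewrite ler_wpM2r ?exprn_ge0 // -[X in X <= _]expr1.
    by apply: ler_weXn2l.
  have -> : B * w%:R ^+ 7 = ((B * w%:R ^+ 7) `^ k%:R) `^ k%:R^-1.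
    by rewrite -powRrM divff ?powRr1 // pnatr_eq0 -lt0n.
  apply: ge0_ler_powR => //; rewrite ?invr_ge0 ?nnegrE ?powR_ge0 //; lra.
have lx : ln (2 * w%:R) <= ln x.
  rewrite ler_ln ?posrE; [|lra..]; apply: le_trans wx.
  by rewrite ler_wpM2l // natrX -[X in X <= _]expr1 ler_weXn2l.
have l2w : 0 < ln (2 * w%:R : R) by rewrite ln_gt0 //; lra.
(* A threshold in terms of w implies the required one in terms of x; ln (2 * w)
   rather than ln w keeps the denominator positive when w = 1. *)
have threshold d : c1 * B <= d -> forall n : nat,
    d * w%:R ^+ 7 / ln (2 * w%:R) <= n%:R ->
    c1 * (x `^ k%:R^-1 / ln x) <= n%:R.
  move=> dB n; apply: le_trans.
  rewrite mulrA; apply: ler_pM.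
  - by rewrite mulr_ge0 ?powR_ge0 // ltW.
  - by rewrite invr_ge0 ltW // (lt_le_trans l2w).
  - apply: le_trans (ler_wpM2l (ltW c1_gt0) rootx) _.
    by rewrite mulrA ler_wpM2r // exprn_ge0.
  - by rewrite lef_pV2 ?posrE // (lt_le_trans l2w).
have Bgt0 : 0 < B by lra.
have c1B : c1 * B = Num.min a l by rewrite /c1 divfK ?gt_eqF.
(* For w = 1 the threshold is compared with ln 2 instead of a. *)
have [w2|w_lt2] := leqP 2 w.
  apply: le_trans (_ : b * (w ^ K)%:R <= _).
    apply: le_trans (ler_wpM2l (ltW c2_gt0) xB) _.
    rewrite mulrA natrX ler_wpM2r ?exprn_ge0 // /c2 divfK ?gt_eqF //.
    by rewrite ge_min lexx orbT.
  apply: le_trans (Hab w w2) _; rewrite ler_nat cardE.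
  rewrite -(size_map (fun n : 'I_(w ^ K).*2.+1 => n : nat)).
  apply: size_le_fset_set; first exact: finite_upto.
    by rewrite map_inj_uniq ?enum_uniq //; apply: val_inj.
  move=> _ /mapP[n + ->]; rewrite mem_enum inE => Hn.
  have nx : n%:R <= x.
    apply: le_trans wx; rewrite -natrM ler_nat mul2n -ltnS; exact: ltn_ord.
  have lw : 0 < ln (w%:R : R) by rewrite ln_gt0 // (ltr_nat _ 1).
  have Hn' : P1 n.
    apply: (threshold a); first by rewrite c1B ge_min lexx.
    apply: le_trans Hn; rewrite ler_wpM2l //.
      by rewrite mulr_ge0 ?exprn_ge0 // ltW.
    by rewrite lef_pV2 ?posrE // ler_ln ?posrE; lra.
  split=> //; rewrite lt0n; apply/negP => /eqP n0.
  have : (0 < repr_count k n)%N.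
    rewrite -(ltr0n R); apply: lt_le_trans Hn.
    by rewrite divr_gt0 // mulr_gt0 // exprn_gt0 //; lra.
  move=> /repr_count_gt0[p [j [/prime_gt0 p0 _]]] /eqP.
  by rewrite n0 addn_eq0 -leqn0 leqNgt p0.
have w_eq1 : w = 1%N by apply/eqP; rewrite eqn_leq w1 -ltnS w_lt2.
have w1R : w%:R = 1 :> R by rewrite w_eq1.
rewrite w1R expr1n mulr1 in xB.
apply: le_trans (_ : 1 <= _).
  apply: le_trans (ler_wpM2l (ltW c2_gt0) xB) _.
  by rewrite /c2 divfK ?gt_eqF // ge_min lexx.
rewrite (ler_nat _ 1); apply: (size_le_fset_set (s := [:: 3])) => //.
  exact: finite_upto.
move=> n; rewrite inE => /eqP ->; split=> //.
have r3 : (0 < repr_count k 3)%N.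
  apply: (size_le_fset_set (s := [:: (2, 1)%N])) => //.
    exact: finite_representations.
  by move=> q; rewrite inE => /eqP ->; split=> //=; rewrite exp1n.
apply: (threshold l); first by rewrite c1B ge_min lexx orbT.
rewrite w1R expr1n !mulr1 divff ?gt_eqF //.
by rewrite (ler_nat _ 1).
Qed.
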